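(* Let $\Pi$ be a (finite, nonempty) set of patterns, the longest of which has length $k$. The values $|S_1(\Pi)|,\dots,|S_n(\Pi)|$ can be computed in time $O(|S_{\le n-1}(\Pi)|\cdot k)$. Moreover, the set $S_{\le n}(\Pi)$ can be constructed in time $O(|S_{\le n-1}(\Pi)|\cdot k+|S_n(\Pi)|)$.
   Context: A permutation in $S_n$ is a word containing each of $1,\dots,n$ exactly once; $S_{\le n}=S_1\cup\dots\cup S_n$. For $\pi\in S_k$ and $\tau\in S_n$, a $\pi$-hit in $\tau$ is a $k$-letter subsequence of $\tau$ order-isomorphic to $\pi$; $\tau$ avoids $\Pi$ if it has no $\pi$-hit for any $\pi\in\Pi$; $S_n(\Pi)$ (resp. $S_{\le n}(\Pi)$) is the set of permutations in $S_n$ (resp. $S_{\le n}$) avoiding $\Pi$. Model of computation: a word RAM with words of $\Theta(n)$ bits (more precisely, enough that a permutation of length at most $n$, encoded with each letter in a fixed-width bit block, as well as an $(n+1)$-bit map, fits in a constant number of words), in which standard integer operations (arithmetic, bitwise operations, bit shifts), the instruction popcount (number of 1-bits of a word) and the instruction ctz (number of trailing zero bits of a word) each take constant time, and hash tables keyed by such words support insertion and membership queries in constant time.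
   Formalization: Both time bounds carry an extra ''+1'', since when S_{≤n-1}(Π) is empty (e.g. Π={1}) the literal bound is 0; Π is given as a hash table (patterns of length at most n) with n, k and the block width, and one word holds a permutation code. *)

(* Defs.v *)
From mathcomp Require Import all_boot.
From Stdlib Require PeanoNat.

Set Implicit Arguments.
Unset Strict Implicit.
Unset Printing Implicit Defensive.

(* A permutation in S_n is a word on the letters 1, ..., n. *)
Definition is_perm (n : nat) (s : seq nat) : bool := perm_eq s (iota 1 n).

Definition order_iso (s p : seq nat) : bool :=
  (size s == size p) &&
  [forall i : 'I_(size p), forall j : 'I_(size p),
     (nth 0 s i < nth 0 s j) == (nth 0 p i < nth 0 p j)].

(* The subsequences of t are the words [mask m t]. *)
Definition has_hit (p t : seq nat) : bool :=
  [exists m : (size t).-tuple bool, order_iso (mask m t) p].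

Definition avoids (Pi : seq (seq nat)) (t : seq nat) : bool :=
  all (fun p => ~~ has_hit p t) Pi.

(* Duplicate-free lists of the elements of S_n(Pi) and of
   S_{<=n}(Pi) = S_1(Pi) u ... u S_n(Pi); the latter does not contain the empty
   word. *)
Definition Av (n : nat) (Pi : seq (seq nat)) : seq (seq nat) :=
  [seq t <- permutations (iota 1 n) | avoids Pi t].

Definition Av_le (n : nat) (Pi : seq (seq nat)) : seq (seq nat) :=
  flatten [seq Av j Pi | j <- iota 1 n].

(* The finite set of patterns is given by a list, of which only the set of
   members matters. *)
Definition pattern_set (Pi : seq (seq nat)) : bool :=
  (Pi != [::]) && all (fun p => (0 < size p) && is_perm (size p) p) Pi.

Definition max_length (Pi : seq (seq nat)) : nat := \max_(p <- Pi) size p.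

(* Letter i of s (counted from 0) occupies the bits b * i, ..., b * i + b - 1. *)
Definition code (b : nat) (s : seq nat) : nat :=
  \sum_(i < size s) nth 0 s i * 2 ^ (b * i).

(* Word RAM with w-bit words.  A word is a natural number below 2 ^ w; a program
   uses finitely many registers, word-indexed arrays and hash tables, each of
   these named by a natural number. *)

Inductive unop := Not | Popcount | Ctz.

Inductive binop :=
  Add | Sub | Mul | Div | Mod | And | Or | Xor | Shl | Shr | Eqw | Ltw.

Inductive expr :=
| Const of nat
| Reg of nat
| Unop of unop & expr
| Binop of binop & expr & expr
| Read of nat & expr            (* Read A i : cell i of array A *)
| Member of nat & expr.         (* Member T x : is x a key of table T? *)

Inductive cmd :=
| Skip
| Assign of nat & expr
| Write of nat & expr & expr    (* Write A i x : cell i of array A becomes x *)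
| Insert of nat & expr          (* Insert T x : x becomes a key of table T *)
| Seq of cmd & cmd
| If of expr & cmd & cmd
| While of expr & cmd.

Record state := State {
  regs : nat -> nat;
  arrs : nat -> nat -> nat;
  tabs : nat -> pred nat
}.

(* Ctz of the zero word is w. *)
Definition eval_unop (w : nat) (o : unop) (x : nat) : nat :=
  match o with
  | Not => (2 ^ w).-1 - x
  | Popcount => count (PeanoNat.Nat.testbit x) (iota 0 w)
  | Ctz => find (PeanoNat.Nat.testbit x) (iota 0 w)
  end.

Definition eval_binop (w : nat) (o : binop) (x y : nat) : nat :=
  match o with
  | Add => (x + y) %% 2 ^ w
  | Sub => (x + (2 ^ w - y)) %% 2 ^ w
  | Mul => (x * y) %% 2 ^ w
  | Div => x %/ y
  | Mod => x %% y
  | And => PeanoNat.Nat.land x y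
  | Or => PeanoNat.Nat.lor x y
  | Xor => PeanoNat.Nat.lxor x y
  | Shl => (x * 2 ^ y) %% 2 ^ w
  | Shr => x %/ 2 ^ y
  | Eqw => x == y
  | Ltw => x < y
  end.

Fixpoint eval (w : nat) (s : state) (e : expr) : nat :=
  match e with
  | Const c => c %% 2 ^ w
  | Reg x => regs s x
  | Unop o e1 => eval_unop w o (eval w s e1)
  | Binop o e1 e2 => eval_binop w o (eval w s e1) (eval w s e2)
  | Read A e1 => arrs s A (eval w s e1)
  | Member T e1 => tabs s T (eval w s e1)
  end.

(* Every constant, register access, operation, array access and hash table
   access takes one unit of time. *)
Fixpoint ecost (e : expr) : nat :=
  match e with
  | Const _ | Reg _ => 1
  | Unop _ e1 | Read _ e1 | Member _ e1 => (ecost e1).+1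
  | Binop _ e1 e2 => (ecost e1 + ecost e2).+1
  end.

Definition upd (X : Type) (f : nat -> X) (x : nat) (v : X) : nat -> X :=
  fun y => if y == x then v else f y.

Definition set_reg (s : state) (x v : nat) : state :=
  State (upd (regs s) x v) (arrs s) (tabs s).

Definition set_arr (s : state) (A i v : nat) : state :=
  State (regs s) (upd (arrs s) A (upd (arrs s A) i v)) (tabs s).

Definition add_key (s : state) (T x : nat) : state :=
  State (regs s) (arrs s) (upd (tabs s) T (upd (tabs s T) x true)).

(* [exec w c s t s'] : started in state s, the command c halts in state s' after
   t units of time. *)
Inductive exec (w : nat) : cmd -> state -> nat -> state -> Prop :=
| exec_skip s :
    exec w Skip s 1 s
| exec_assign s x e :
    exec w (Assign x e) s (ecost e).+1 (set_reg s x (eval w s e))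
| exec_write s A e1 e2 :
    exec w (Write A e1 e2) s (ecost e1 + ecost e2).+1
      (set_arr s A (eval w s e1) (eval w s e2))
| exec_insert s T e :
    exec w (Insert T e) s (ecost e).+1 (add_key s T (eval w s e))
| exec_seq s1 s2 s3 c1 c2 t1 t2 :
    exec w c1 s1 t1 s2 -> exec w c2 s2 t2 s3 ->
    exec w (Seq c1 c2) s1 (t1 + t2) s3
| exec_if_true s s' e c1 c2 t :
    eval w s e != 0 -> exec w c1 s t s' ->
    exec w (If e c1 c2) s (ecost e + t).+1 s'
| exec_if_false s s' e c1 c2 t :
    eval w s e = 0 -> exec w c2 s t s' ->
    exec w (If e c1 c2) s (ecost e + t).+1 s'
| exec_while_false s e c :
    eval w s e = 0 ->
    exec w (While e c) s (ecost e).+1 s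
| exec_while_true s1 s2 s3 e c t1 t2 :
    eval w s1 e != 0 -> exec w c s1 t1 s2 -> exec w (While e c) s2 t2 s3 ->
    exec w (While e c) s1 (ecost e + t1 + t2).+1 s3.

Lemma exec_det w c s t1 s1 t2 s2 :
  exec w c s t1 s1 -> exec w c s t2 s2 -> t1 = t2 /\ s1 = s2.
Proof.
move=> H; elim: H t2 s2 => {c s t1 s1} *;
  match goal with H : exec _ _ _ _ _ |- _ => inversion H; subst end => //;
  repeat match goal with
  | e0 : is_true (?x != 0), e1 : ?x = 0 |- _ => by rewrite e1 in e0
  | IH : (forall t s, exec _ ?c ?s1 t s -> _), H : exec _ ?c ?s1 _ _ |- _ =>
      have [? ?] := IH _ _ H; subst; clear H
  end; by [].
Qed.

(* A permutation of length at most n, coded with b bits per letter, fits in a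
   word, and so do an (n+1)-bit map and the input parameter k. *)
Definition word_size_ok (n k b w : nat) : bool :=
  [&& n < 2 ^ b, n * b <= w, n < w & k < 2 ^ w].

(* Input: n, k and the block width b in registers 0, 1, 2, and the patterns in
   hash table 0.  A pattern of length more than n need not fit in a word, and no
   permutation of length at most n has a hit of it; such patterns are not
   stored.  All other registers and all arrays are 0, all other tables empty. *)
Definition input (n b : nat) (Pi : seq (seq nat)) : state :=
  State (nth 0 [:: n; max_length Pi; b])
        (fun _ _ => 0)
        (fun T => [pred x | (T == 0) &&
                     (x \in [seq code b p | p <- Pi & size p <= n])]).

(* |S_j(Pi)| is in cell j of array 0, for 1 <= j <= n. *)
Definition outputs_counts (n : nat) (Pi : seq (seq nat)) (s : state) : Prop :=
  forall j, 1 <= j <= n -> arrs s 0 j = size (Av j Pi).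

(* Array 0 starts with a list, without repetition, of the codes of the elements
   of S_{<=n}(Pi), and register 0 contains the length of that list. *)
Definition outputs_set (n b : nat) (Pi : seq (seq nat)) (s : state) : Prop :=
  perm_eq [seq arrs s 0 i | i <- iota 0 (regs s 0)]
          [seq code b t | t <- Av_le n Pi].

Definition computes_within (c : cmd) (w : nat) (s : state)
    (post : state -> Prop) (T : nat) : Prop :=
  exists t s', [/\ exec w c s t s', post s' & t <= T].

(* Main.v *)
Require Import Defs.
From mathcomp Require Import all_boot.
From mathcomp Require Import zify.
From Stdlib Require Import FunctionalExtensionality.

Set Implicit Arguments.
Unset Strict Implicit.
Unset Printing Implicit Defensive.

(* Words are generated by length: a word t of S_m(Pi) is extended by inserting
   the letter m + 1 at each position of a bit map ext(t), the set of positions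
   for which the result still avoids Pi.  A hit has at most k letters, so a word u
   avoids Pi as soon as u is not in Pi and every word obtained from u by deleting
   one of its k + 1 largest letters (or one of its letters, if there are fewer)
   avoids Pi.  For u = t with m + 1 inserted at i, deleting m + 1 gives t, and
   deleting j <= m gives the word del j t with m inserted at i, or at i - 1 if i
   is to the right of the letter j.  Hence ext(t) is the intersection of at most
   k bit maps ext(del j t), each with one bit doubled at the position of j, and of
   the set of positions not leading into Pi, which only has to be computed when
   m < k and then takes m + 1 <= k membership queries.  Each of the k deletions
   takes constant time: for j = m, m - 1, ... the word with all letters above j
   lowered by one changes by one subtraction, and the positions of the k largest
   letters of t are packed in one word that is obtained in time O(k) from that of
   the parent of t.  Counting the last level takes one popcount per parent. *)

(** * Patterns and deletion of letters *)

Lemma order_isoP s p :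
  reflect (size s = size p /\ forall i j, i < size p -> j < size p ->
             (nth 0 s i < nth 0 s j) = (nth 0 p i < nth 0 p j))
          (order_iso s p).
Proof.
apply: (iffP andP) => [[/eqP ss /forallP iso]|[ss iso]]; split=> //.
- by move=> i j ip jp; have /forallP/(_ (Ordinal jp))/eqP := iso (Ordinal ip).
- exact/eqP.
- by apply/forallP=> i; apply/forallP=> j; apply/eqP/iso.
Qed.

Lemma has_hitP p t :
  reflect (exists2 u, subseq u t & order_iso u p) (has_hit p t).
Proof.
apply: (iffP existsP) => [[m iso]|[u /subseqP[m sm ->] iso]].
  by exists (mask m t); first exact: mask_subseq.
by exists (tcast sm (in_tuple m)); rewrite val_tcast.
Qed.

Lemma order_iso_map (f : nat -> nat) u p :
  {in u &, forall x y, (f x < f y) = (x < y)} ->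
  order_iso (map f u) p = order_iso u p.
Proof.
move=> fm; apply/order_isoP/order_isoP; rewrite size_map => -[su iso];
  split=> // i j ip jp; rewrite -iso //;
  by rewrite !(nth_map 0) ?su // fm // mem_nth ?su.
Qed.

Lemma is_permP n s : is_perm n s -> [/\ uniq s, size s = n & s =i iota 1 n].
Proof.
move=> ps; split; last exact: perm_mem.
  by rewrite (perm_uniq ps) iota_uniq.
by rewrite (perm_size ps) size_iota.
Qed.

Lemma mem_is_perm n s x : is_perm n s -> (x \in s) = (0 < x <= n).
Proof. by case/is_permP=> _ _ ->; rewrite mem_iota add1n ltnS. Qed.

Lemma is_perm_uniq_sub n s :
  uniq s -> size s = n -> {subset s <= iota 1 n} -> is_perm n s.
Proof.
move=> us ss sub; apply: uniq_perm; rewrite ?iota_uniq //.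
by have [] := uniq_min_size us sub; rewrite ?size_iota ?ss.
Qed.

(** The letters below a letter [v] are exactly [1, ..., v - 1]. This recovers every letter from the
    relative order alone, so that order-isomorphic permutations coincide. *)
Lemma nth_is_perm n s i :
  is_perm n s -> i < n ->
  nth 0 s i = (count (fun j => nth 0 s j < nth 0 s i) (iota 0 n)).+1.
Proof.
move=> ps ltin; have [us ss _] := is_permP ps.
have: 0 < nth 0 s i <= n by rewrite -(mem_is_perm _ ps) mem_nth ?ss.
set v := nth 0 s i => /andP[v0 vn].
have -> : count (fun j => nth 0 s j < v) (iota 0 n) = count (ltn^~ v) s.
  rewrite -{2}[s](mkseq_nth 0) count_map ss.
  exact: eq_count.
have /permP -> : perm_eq s (iota 1 n) by [].
have -> : n = v.-1 + (n - v.-1) by lia.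
rewrite iotaD count_cat [X in _ = (_ + X).+1](_ : _ = 0); last first.
  by apply/eqP; rewrite -leqn0 leqNgt -has_count; apply/hasP=> -[x]; rewrite mem_iota /=; lia.
rewrite [X in (X + 0).+1](_ : _ = v.-1); first by lia.
rewrite -[RHS](size_iota 1); apply/eqP; rewrite -all_count; apply/allP=> x.
by rewrite mem_iota /=; lia.
Qed.

Lemma order_iso_perm_eq n s p :
  is_perm n s -> is_perm n p -> order_iso s p -> s = p.
Proof.
move=> ps pp /order_isoP[ssp iso]; have [_ sp _] := is_permP pp.
apply: (@eq_from_nth _ 0) => // i; rewrite ssp sp => lti.
rewrite (nth_is_perm ps) // (nth_is_perm pp) //; congr _.+1.
by apply: eq_in_count => j; rewrite mem_iota => /andP[_ ltj]; rewrite iso ?sp.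
Qed.

Lemma order_iso_refl s : order_iso s s.
Proof. exact/order_isoP. Qed.

(** Standardization after the removal of [j]: the boolean, read as 0 or 1, closes the gap. *)
Definition lower (j x : nat) : nat := x - (j < x).

Definition del (j : nat) (t : seq nat) : seq nat := map (lower j) (rem j t).

Definition ins (t : seq nat) (i v : nat) : seq nat := take i t ++ v :: drop i t.

(** Only [j] and [j + 1] collide under [lower j]; away from [j] it is strictly increasing and so
    respects order isomorphism. *)
Lemma lower_mono j (u : seq nat) :
  j \notin u -> {in u &, forall x y, (lower j x < lower j y) = (x < y)}.
Proof.
move=> ju x y xu yu.
have /eqP xj : x != j by apply: contraNneq ju => <-.
have /eqP yj : y != j by apply: contraNneq ju => <-.
by rewrite /lower; lia.
Qed.

Lemma has_hit_del p j t : uniq t -> has_hit p (del j t) -> has_hit p t.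
Proof.
move=> ut /has_hitP[_ /subseqP[m _ ->]]; rewrite -map_mask.
have sub : subseq (mask m (rem j t)) (rem j t) by exact: mask_subseq.
rewrite order_iso_map => [iso|].
  by apply/has_hitP; exists (mask m (rem j t)); first exact: subseq_trans sub (rem_subseq _ _).
apply: lower_mono; apply/negP=> /(mem_subseq sub).
by rewrite mem_rem_uniq // inE eqxx.
Qed.

Lemma has_hit_del_notin p j t u :
  uniq t -> subseq u t -> j \notin u -> order_iso u p -> has_hit p (del j t).
Proof.
move=> ut sub ju iso; apply/has_hitP; exists (map (lower j) u).
  rewrite map_subseq // rem_filter // subseq_filter sub andbT.
  by apply/allP=> x xu /=; apply: contraNneq ju => <-.
by rewrite order_iso_map //; exact: lower_mono.
Qed.

(* A hit has at most k letters, so it misses one of any k + 1 letters of t; if t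
   has at most k letters then a hit using all of them is t itself. *)
Lemma avoids_del Pi N t :
  pattern_set Pi -> is_perm N t ->
  avoids Pi t = (t \notin Pi) &&
    all (fun l => avoids Pi (del (N - l) t)) (iota 0 (minn (max_length Pi).+1 N)).
Proof.
move=> /andP[_ /allP patPi] pt; have [ut st mt] := is_permP pt.
apply/idP/andP => [/allP av|[tPi /allP avd]].
  split.
    apply/negP=> /av/negP[]; apply/has_hitP; exists t; first exact: subseq_refl.
    exact: order_iso_refl.
  apply/allP=> l _; apply/allP=> p /av; apply: contraNN; exact: has_hit_del.
apply/allP=> p pPi; apply/negP=> /has_hitP[u sub iso].
have /andP[_ pp] := patPi _ pPi.
have [sup _] := order_isoP _ _ iso.
have lek : size p <= max_length Pi by rewrite /max_length (big_rem p pPi) leq_maxl.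
have [_ eqs] := size_subseq_leqif sub.
(* If the hit uses all letters of [t], then [t] is order-isomorphic to [p], hence equal to it,
   against [t \notin Pi]. *)
have [eqN|neN] := eqVneq (size u) N.
  move: eqs; rewrite eqN st eqxx => /esym/eqP ut'; subst u.
  by move: pp; rewrite -sup eqN => pp; rewrite (order_iso_perm_eq pt pp iso) pPi in tPi.
have ltN : size u < N.
  by have := size_subseq sub; rewrite st; move/eqP: neN; lia.
(* [J] consists of the largest letters of [t]: one more than the longest pattern has, or all [N] of
   them if there are fewer. Either way [u] is too short to contain all of [J]. *)
set J := [seq N - l | l <- iota 0 (minn (max_length Pi).+1 N)].
have uJ : uniq J.
  rewrite map_inj_in_uniq ?iota_uniq // => x y.
  by rewrite !mem_iota; lia.
have : ~~ all (mem u) J.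
  apply/negP=> /allP /(uniq_leq_size uJ); rewrite size_map size_iota.
  rewrite geq_min sup ltnNge lek leqNgt -sup ltN.
  by [].
case/allPn=> _ /mapP[l lJ ->] ju.
have /allP/(_ _ pPi)/negP := avd _ lJ; apply.
exact: has_hit_del_notin iso.
Qed.

Lemma size_ins t i v : size (ins t i v) = (size t).+1.
Proof. by rewrite size_cat /= addnS -size_cat cat_take_drop. Qed.

Lemma is_perm_ins m t i : is_perm m t -> is_perm m.+1 (ins t i m.+1).
Proof.
move=> pt; rewrite /is_perm -addn1 iotaD /= add1n addn1 perm_sym perm_catC /= perm_sym.
rewrite /ins (perm_catCA _ [:: m.+1]) /= perm_cons cat_take_drop.
exact: pt.
Qed.

Lemma rem_notin_cat (T : eqType) (x : T) s1 s2 :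
  x \notin s1 -> rem x (s1 ++ s2) = s1 ++ rem x s2.
Proof.
elim: s1 => //= y s1 IH; rewrite inE negb_or eq_sym => /andP[/negPf-> /IH->].
by [].
Qed.

Lemma rem_in_cat (T : eqType) (x : T) s1 s2 :
  x \in s1 -> rem x (s1 ++ s2) = rem x s1 ++ s2.
Proof.
elim: s1 => //= y s1 IH; rewrite inE eq_sym; case: eqP => //= _ /IH ->.
by [].
Qed.

Lemma rem_ins (t : seq nat) i v : v \notin t -> rem v (ins t i v) = t.
Proof.
move=> vt; rewrite rem_notin_cat /= ?eqxx ?cat_take_drop //.
by apply: contra vt; exact: mem_take.
Qed.

Lemma index_ins (t : seq nat) i v :
  v \notin t -> i <= size t -> index v (ins t i v) = i.
Proof.
move=> vt it; rewrite index_cat ifN; last by apply: contra vt; exact: mem_take.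
by rewrite /= eqxx addn0 size_takel.
Qed.

Lemma ins_index_rem (t : seq nat) v : v \in t -> ins (rem v t) (index v t) v = t.
Proof.
move=> vt; rewrite /ins remE.
have si : index v t <= size t by rewrite index_size.
rewrite take_size_cat ?size_takel // drop_size_cat ?size_takel //.
rewrite -[in RHS](cat_take_drop (index v t) t); congr (_ ++ _).
by rewrite [RHS](drop_nth v) ?index_mem // nth_index.
Qed.

Lemma index_ins_neq (t : seq nat) i v j :
  j \in t -> j != v -> i <= size t ->
  index j (ins t i v) = index j t + (i <= index j t).
Proof.
move=> jt jv it; rewrite index_cat -[t in RHS](cat_take_drop i) index_cat.
rewrite size_takel //; case: ifP => [jA|_] /=.
  by have := index_mem j (take i t); rewrite jA size_takel //; lia.
by rewrite eq_sym (negPf jv); lia.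
Qed.

(** As [j <= m], the letter [m + 1] drops to [m]; the gap [i] moves one place to the left when [j]
    stands before it. *)
Lemma del_ins m t i j :
  is_perm m t -> j \in t -> i <= m ->
  del j (ins t i m.+1) = ins (del j t) (i - (index j t < i)) m.
Proof.
move=> pt jt im; have [ut st _] := is_permP pt.
have jm : 0 < j <= m by rewrite -(mem_is_perm _ pt).
have low : lower j m.+1 = m by rewrite /lower; lia.
have insE A B v : ins (A ++ B) (size A) v = A ++ v :: B.
  by rewrite /ins take_size_cat // drop_size_cat.
have cond : (index j t < i) = (j \in take i t).
  rewrite -[t in LHS](cat_take_drop i) index_cat size_takel ?st //.
  case: ifP => [jA|_]; last by lia.
  by have := index_mem j (take i t); rewrite jA size_takel ?st.
rewrite cond /del /ins; set A := take i t; set B := drop i t.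
have tE : t = A ++ B by rewrite cat_take_drop.
have sA : size A = i by rewrite size_takel ?st.
case: (boolP (j \in A)) => [jA|jA] /=.
  rewrite rem_in_cat // map_cat /= low tE rem_in_cat // map_cat -/(ins _ _ m).
  by rewrite -insE size_map size_rem // sA subn1.
rewrite rem_notin_cat //= [m.+1 == j](_ : _ = false) ?tE; last by apply/eqP; lia.
rewrite rem_notin_cat // !map_cat /= low -/(ins _ _ m) subn0.
by rewrite -insE size_map sA.
Qed.

Lemma is_perm_del m t j : is_perm m t -> j \in t -> is_perm m.-1 (del j t).
Proof.
move=> pt jt; have [ut st mt] := is_permP pt.
have jr : j \notin rem j t by rewrite mem_rem_uniq // inE eqxx.
apply: is_perm_uniq_sub.
- rewrite map_inj_in_uniq ?rem_uniq // => x y xr yr.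
  by have := lower_mono jr xr yr; have := lower_mono jr yr xr; lia.
- by rewrite size_map size_rem // st.
- move=> _ /mapP[x xr ->].
  have : x != j by apply/eqP=> xj; move: jr; rewrite -{1}xj xr.
  have := mem_rem xr; have := jt; rewrite !(mem_is_perm _ pt) mem_iota /lower.
  by move=> ? ? /eqP; lia.
Qed.

Lemma avoids_del_perm Pi m t j :
  pattern_set Pi -> is_perm m t -> avoids Pi t -> avoids Pi (del j t).
Proof.
move=> pPi pt; have [ut _ _] := is_permP pt.
move=> /allP av; apply/allP=> p /av; apply: contraNN; exact: has_hit_del.
Qed.

Lemma del_max m t i : is_perm m t -> del m.+1 (ins t i m.+1) = t.
Proof.
move=> pt; rewrite /del rem_ins ?(mem_is_perm _ pt) ?ltnn //.
rewrite -[RHS]map_id; apply/eq_in_map => x.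
by rewrite (mem_is_perm _ pt) /lower; lia.
Qed.

(** The instance [N = m + 1] of [avoids_del]. Its term [l = 0] removes [m + 1] and gives back [t],
    which avoids [Pi], so at most [max_length Pi] lookups remain. *)
Lemma avoids_ins Pi m t i :
  pattern_set Pi -> is_perm m t -> avoids Pi t -> i <= m ->
  avoids Pi (ins t i m.+1) = (ins t i m.+1 \notin Pi) &&
    all (fun l => avoids Pi (ins (del (m - l) t) (i - (index (m - l) t < i)) m))
        (iota 0 (minn (max_length Pi) m)).
Proof.
move=> pPi pt at_ im; rewrite (avoids_del pPi (is_perm_ins i pt)); congr andb.
rewrite minnSS /= subn0 del_max // at_ /= -[1]addn0 iotaDl all_map.
apply: eq_in_all => l; rewrite mem_iota => /andP[_ lm] /=.
by rewrite add1n subSS del_ins // (mem_is_perm _ pt); lia.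
Qed.

(** * The generation tree *)

Definition kids (Pi : seq (seq nat)) (t : seq nat) : seq (seq nat) :=
  [seq ins t i (size t).+1 |
     i <- iota 0 (size t).+1 & avoids Pi (ins t i (size t).+1)].

Fixpoint level (Pi : seq (seq nat)) (m : nat) : seq (seq nat) :=
  if m is m'.+1 then flatten (map (kids Pi) (level Pi m')) else [:: [::]].

(** [g] recovers from an element the block that it lies in, so the blocks are pairwise disjoint. *)
Lemma flatten_map_uniq (S T : eqType) (f : S -> seq T) (g : T -> S) s :
  uniq s -> {in s, forall x, uniq (f x)} ->
  {in s, forall x, {in f x, forall y, g y = x}} ->
  uniq (flatten (map f s)).
Proof.
elim: s => //= x s IH /andP[xs us] uf gf; rewrite cat_uniq uf ?mem_head //=.
rewrite IH ?andbT //; last 2 first.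
- by move=> y ys; apply: uf; rewrite inE ys orbT.
- by move=> y ys; apply: gf; rewrite inE ys orbT.
apply/hasPn=> z /flatten_mapP[y ys zy]; apply: contra xs => zx.
by rewrite -(gf x _ z) ?mem_head // (gf y _ z) // inE ys orbT.
Qed.

Lemma avoids_nil Pi : pattern_set Pi -> avoids Pi [::].
Proof.
case/andP=> _ /allP pat; apply/allP=> p /pat /andP[p0 _]; apply/has_hitP=> -[u].
rewrite subseq0 => /eqP-> /order_isoP[sp _].
by rewrite -sp in p0.
Qed.

(** Removing the largest letter of an avoiding word leaves an avoiding word one level up, and
    reinserting the letter at its position gives the word back; so the tree misses none. *)
Lemma mem_level Pi m t :
  pattern_set Pi -> (t \in level Pi m) = is_perm m t && avoids Pi t.
Proof.
move=> pPi; elim: m t => [|m IH] t /=.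
  rewrite inE; apply/eqP/andP => [->|[/perm_size/size0nil]] //.
  by split=> //; exact: avoids_nil.
apply/flatten_mapP/andP => [[s]|[pt at_]].
  rewrite IH => /andP[ps _] /mapP[i]; have [_ -> _] := is_permP ps.
  by rewrite mem_filter => /andP[av _] ->; split=> //; exact: is_perm_ins.
have mt : m.+1 \in t by rewrite (mem_is_perm _ pt); lia.
have [ut st _] := is_permP pt.
have mr : m.+1 \notin rem m.+1 t by rewrite mem_rem_uniq // inE eqxx.
have rd : rem m.+1 t = del m.+1 t.
  rewrite /del -[LHS]map_id; apply/eq_in_map => x /mem_rem.
  by rewrite (mem_is_perm _ pt) /lower; lia.
exists (rem m.+1 t).
  by rewrite IH rd (is_perm_del pt) // (avoids_del_perm _ _ pt).
apply/mapP; exists (index m.+1 t); last by rewrite size_rem // st /= ins_index_rem.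
rewrite mem_filter size_rem // st ins_index_rem // at_ mem_iota add0n -st index_mem.
by rewrite leq0n st.
Qed.

Lemma uniq_kids Pi m t : is_perm m t -> uniq (kids Pi t).
Proof.
move=> pt; have [_ st _] := is_permP pt.
have mt : m.+1 \notin t by rewrite (mem_is_perm _ pt) ltnn.
rewrite map_inj_in_uniq ?filter_uniq ?iota_uniq // st => i j.
rewrite !mem_filter !mem_iota => /andP[_ /andP[_ im]] /andP[_ /andP[_ jm]] eqij.
by rewrite -(@index_ins t i m.+1) ?st // eqij index_ins ?st.
Qed.

Lemma uniq_level Pi m : pattern_set Pi -> uniq (level Pi m).
Proof.
move=> pPi; elim: m => //= m IH.
apply: (@flatten_map_uniq _ _ _ (rem m.+1)) => // t.
  by rewrite mem_level // => /andP[pt _]; exact: uniq_kids pt.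
rewrite mem_level // => /andP[pt _] _ /mapP[i _ ->].
have [_ -> _] := is_permP pt.
by rewrite rem_ins // (mem_is_perm _ pt) ltnn.
Qed.

Lemma level_Av Pi m : pattern_set Pi -> perm_eq (level Pi m) (Av m Pi).
Proof.
move=> pPi; apply: uniq_perm; rewrite ?uniq_level ?filter_uniq ?permutations_uniq //.
by move=> t; rewrite mem_level // mem_filter mem_permutations andbC.
Qed.

(* S_{<=m}(Pi), in the order in which the algorithm finds it. *)
Definition levels (Pi : seq (seq nat)) (m : nat) : seq (seq nat) :=
  flatten [seq level Pi j | j <- iota 1 m].

Lemma flatten_map_iotaS (T : Type) (F : nat -> seq T) m :
  flatten (map F (iota 1 m.+1)) = flatten (map F (iota 1 m)) ++ F m.+1.
Proof. by rewrite -[in LHS](addn1 m) iotaD map_cat flatten_cat /= cats0. Qed.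

Lemma levelsS Pi m : levels Pi m.+1 = levels Pi m ++ level Pi m.+1.
Proof. exact: flatten_map_iotaS. Qed.

Lemma levels_Av_le Pi m : pattern_set Pi -> perm_eq (levels Pi m) (Av_le m Pi).
Proof.
move=> pPi; elim: m => // m IH; rewrite levelsS /Av_le flatten_map_iotaS.
by rewrite perm_cat // level_Av.
Qed.

Lemma mem_levels Pi m t : pattern_set Pi ->
  (t \in levels Pi m) = [&& 0 < size t <= m, is_perm (size t) t & avoids Pi t].
Proof.
move=> pPi; apply/flatten_mapP/and3P => [[j]|[szt pt av]].
  rewrite mem_iota mem_level // => jm /andP[pt av].
  by have [_ -> _] := is_permP pt; split=> //; lia.
by exists (size t); rewrite ?mem_iota ?mem_level ?pt //; lia.
Qed.

Lemma uniq_levels Pi m : pattern_set Pi -> uniq (levels Pi m).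
Proof.
move=> pPi; apply: (@flatten_map_uniq _ _ _ size); rewrite ?iota_uniq //.
  by move=> j _; exact: uniq_level.
by move=> j _ t; rewrite mem_level // => /andP[/is_permP[]].
Qed.

Lemma size_level Pi m : pattern_set Pi -> size (level Pi m) = size (Av m Pi).
Proof. by move=> pPi; exact: perm_size (level_Av m pPi). Qed.

Lemma size_levels Pi m : pattern_set Pi -> size (levels Pi m) = size (Av_le m Pi).
Proof. by move=> pPi; exact: perm_size (levels_Av_le m pPi). Qed.

(** * Packed words and bit maps *)

Local Notation testbit := PeanoNat.Nat.testbit.

Lemma modnMDr m q d : (m + q * d) %% d = m %% d.
Proof. by rewrite addnC modnMDl. Qed.

Lemma divnMDr m q d : 0 < d -> (m + q * d) %/ d = m %/ d + q.
Proof. by move=> d0; rewrite addnC divnMDl // addnC. Qed.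

Section Code.

Variable b : nat.

Lemma code_nil : code b [::] = 0.
Proof. by rewrite /code big_ord0. Qed.

Lemma code_cons x s : code b (x :: s) = x + code b s * 2 ^ b.
Proof.
rewrite /code big_ord_recl /= muln0 expn0 muln1 big_distrl; congr addn.
by apply: eq_bigr => i _; rewrite /= /bump leq0n mulnS expnD mulnAC mulnA.
Qed.

Lemma code_cat s1 s2 : code b (s1 ++ s2) = code b s1 + code b s2 * 2 ^ (b * size s1).
Proof.
elim: s1 => [|x s1 IH]; first by rewrite code_nil muln0 muln1.
by rewrite /= !code_cons IH mulnS expnD; lia.
Qed.

Lemma code_lt s : all (fun x => x < 2 ^ b) s -> code b s < 2 ^ (b * size s).
Proof.
elim: s => [|x s IH] /=; first by rewrite code_nil muln0.
by case/andP=> xb /IH; rewrite code_cons mulnS expnD; nia.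
Qed.

Lemma code_take_lt s i : all (fun x => x < 2 ^ b) s -> i <= size s ->
  code b (take i s) < 2 ^ (b * i).
Proof.
move=> bs le; rewrite -[i in X in _ < X](size_takel le) code_lt //.
by apply/allP=> x /mem_take /(allP bs).
Qed.

Lemma code_take s i : all (fun x => x < 2 ^ b) s -> i <= size s ->
  code b (take i s) = code b s %% 2 ^ (b * i).
Proof.
move=> bs le; rewrite -[s in RHS](cat_take_drop i) code_cat size_takel //.
by rewrite modnMDr modn_small // code_take_lt.
Qed.

Lemma code_drop s i : all (fun x => x < 2 ^ b) s -> i <= size s ->
  code b (drop i s) = code b s %/ 2 ^ (b * i).
Proof.
move=> bs le; rewrite -[s in RHS](cat_take_drop i) code_cat size_takel //.
by rewrite divnMDr ?expn_gt0 // divn_small // code_take_lt.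
Qed.

(** The blocks below the gap, the new letter, and the remaining blocks moved up by one block.
    [child_code] evaluates this formula. *)
Lemma code_ins s i v : all (fun x => x < 2 ^ b) s -> i <= size s ->
  code b (ins s i v) = code b s %% 2 ^ (b * i) + v * 2 ^ (b * i)
                       + code b s %/ 2 ^ (b * i) * 2 ^ (b * i + b).
Proof.
move=> bs le; rewrite code_cat code_cons code_take // code_drop // size_takel //.
by rewrite expnD; lia.
Qed.

Lemma code_remove s i : all (fun x => x < 2 ^ b) s -> i < size s ->
  code b (take i s ++ drop i.+1 s) =
  code b s %% 2 ^ (b * i) + code b s %/ 2 ^ (b * i + b) * 2 ^ (b * i).
Proof.
move=> bs lt; rewrite code_cat code_take ?(ltnW lt) // code_drop //.
by rewrite size_takel ?(ltnW lt) // mulnS [b + _]addnC.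
Qed.

(** Letters are digits in base [2 ^ b]; excluding the digit 0 separates a word from its extensions
    by zeros. *)
Lemma code_inj s t :
  all (fun x => 0 < x < 2 ^ b) s -> all (fun x => 0 < x < 2 ^ b) t ->
  code b s = code b t -> s = t.
Proof.
elim: s t => [|x s IH] [|y t] //=; rewrite ?code_nil ?code_cons; try lia.
case/andP=> /andP[x0 xb] bs /andP[/andP[y0 yb] bt] eqc.
have eqxy : x = y.
  by have := congr1 (modn^~ (2 ^ b)) eqc; rewrite /= !modnMDr !modn_small.
rewrite eqxy; congr cons; apply: IH => //.
by move/eqP: eqc; rewrite eqxy eqn_add2l eqn_pmul2r ?expn_gt0 // => /eqP.
Qed.

(** [lower j] and [lower j.-1] differ only at the letter [j], and there by one. Hence passing to the
    next smaller deleted letter costs a single subtraction. *)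
Lemma code_lower j s : 0 < j -> uniq s -> j \in s ->
  code b (map (lower j) s) = code b (map (lower j.-1) s) + 2 ^ (b * index j s).
Proof.
move=> j0; elim: s => //= x s IH /andP[xs us]; rewrite inE eq_sym !code_cons.
case: eqP => [xj _|xj] /=.
  have -> : map (lower j.-1) s = map (lower j) s.
    apply/eq_in_map => y ys; rewrite /lower.
    have : y <> j by move=> yj; rewrite xj -yj ys in xs.
    lia.
  by rewrite xj muln0 /lower; lia.
move/(IH us)->; have -> : lower j x = lower j.-1 x by rewrite /lower; lia.
by rewrite mulnS expnD; lia.
Qed.

End Code.

(** * Binary digits of natural numbers *)

Lemma testbitE x i : testbit x i = odd (x %/ 2 ^ i).
Proof.
elim: i x => [|i IH] x.
  by rewrite expn0 divn1 /= /PeanoNat.Nat.odd; elim/ltn_ind: x => -[|[|x]] //= ->; rewrite ?negbK.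
by rewrite /= IH expnS divnMA divn2; congr (odd (_ %/ _)); elim/ltn_ind: x => -[|[|x]] //= ->.
Qed.

Lemma testbit_cat x y q i :
  testbit (x %% 2 ^ q + y * 2 ^ q) i = if i < q then testbit x i else testbit y (i - q).
Proof.
rewrite !testbitE; case: ltnP => [lt|le].
  have e2 : 2 ^ q = 2 ^ (q - i).-1 * 2 * 2 ^ i by rewrite -expnSr -expnD; congr (_ ^ _); lia.
  rewrite {2}(divn_eq x (2 ^ q)) {2}e2 [in RHS]e2 !mulnA.
  rewrite addnC !divnMDl ?expn_gt0 // !oddD !oddM /= !andbF /=.
  by rewrite -e2.
rewrite -{1}(subnKC le) expnD divnMA divnMDr ?expn_gt0 //.
by rewrite [_ %% _ %/ _]divn_small ?ltn_pmod ?expn_gt0.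
Qed.

(** The bits up to [p] stay and the bits from [p] on move up by one, so bit [p] occurs twice. This
    carries out the renumbering of gaps in [del_ins] on a whole bit map at once. *)
Lemma testbit_shift e p i :
  testbit (e %% 2 ^ p.+1 + e %/ 2 ^ p * 2 ^ p.+1) i = testbit e (i - (p < i)).
Proof.
rewrite testbit_cat ltnS leqNgt; case: ltnP => [lt|le] /=; last by rewrite subn0.
by rewrite !testbitE -divnMA -expnD; congr (odd (_ %/ 2 ^ _)); lia.
Qed.

Lemma testbit0 i : testbit 0 i = false.
Proof. by rewrite testbitE div0n. Qed.

Lemma testbit_pow2 (c : bool) i j : testbit (c * 2 ^ i) j = c && (j == i).
Proof.
have := testbit_cat 0 c i j; rewrite mod0n add0n => ->.
rewrite !testbitE div0n; case: ltngtP => [|lt|->] /=; first by rewrite andbF.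
  rewrite divn_small ?andbF //; have := @ltn_expl 2 (j - i) isT.
  by case: c => /=; lia.
by rewrite subnn divn1 andbT oddb.
Qed.

Lemma testbit_ones m i : testbit (2 ^ m - 1) i = (i < m).
Proof.
rewrite testbitE; case: ltnP => [lt|le].
  have -> : 2 ^ m - 1 = (2 ^ (m - i).-1 - 1) * 2 * 2 ^ i + (2 ^ i + (2 ^ i - 1)).
    have -> : 2 ^ m = 2 ^ (m - i).-1 * 2 * 2 ^ i.
      by rewrite -expnSr -expnD; congr (_ ^ _); lia.
    have -> : 2 ^ (m - i).-1 = (2 ^ (m - i).-1).-1.+1 by rewrite prednK ?expn_gt0.
    have : 0 < 2 ^ i by rewrite expn_gt0.
    move: (_.-1) (2 ^ i) => P Q; rewrite subn1 /= => Q0; lia.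
  have p0 : 0 < 2 ^ i by rewrite expn_gt0.
  rewrite divnMDl // -{1}[2 ^ i]mul1n divnMDl // divn_small; last by lia.
  by rewrite !oddD oddM /= andbF.
rewrite divn_small // subn1 prednK ?expn_gt0 //.
by rewrite leq_exp2l.
Qed.

Lemma bits_eq0 x : (forall i, testbit x i = false) -> x = 0.
Proof. by move=> x0; apply: PeanoNat.Nat.bits_inj_0. Qed.

Lemma bits_lt x q : (forall i, q <= i -> testbit x i = false) -> x < 2 ^ q.
Proof.
move=> x0; have : x %/ 2 ^ q = 0.
  apply: bits_eq0 => i; rewrite testbitE -divnMA -expnD -testbitE x0 //; lia.
by move=> q0; rewrite (divn_eq x (2 ^ q)) q0 ltn_pmod ?expn_gt0.
Qed.

Lemma land_bool (c d : bool) : PeanoNat.Nat.land c d = (c && d).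
Proof. by case: c; case: d. Qed.

Lemma ctzE w x i l :
  sorted ltn (i :: l) -> (forall j, testbit x j = (j \in i :: l)) -> i < w ->
  find (testbit x) (iota 0 w) = i.
Proof.
move=> sl bx iw.
have -> : iota 0 w = iota 0 i ++ i :: iota i.+1 (w - i.+1).
  by rewrite -[_ :: _]/(iota (0 + i) (w - i.+1).+1) -iotaD; congr iota; lia.
rewrite find_cat ifN ?size_iota /= ?bx ?mem_head ?addn0 //.
apply/hasPn=> j; rewrite mem_iota bx inE => /andP[_ ji].
apply/norP; split; first by apply/eqP; lia.
apply/negP=> jl; have /allP/(_ _ jl) := order_path_min ltn_trans sl; lia.
Qed.

Lemma popcountE w x l :
  uniq l -> {in l, forall i, i < w} -> (forall j, testbit x j = (j \in l)) ->
  count (testbit x) (iota 0 w) = size l.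
Proof.
move=> ul lw bx; rewrite -size_filter; apply/perm_size/uniq_perm => //.
  by rewrite filter_uniq ?iota_uniq.
move=> i; rewrite mem_filter bx mem_iota /= andb_idr // => /lw; lia.
Qed.

Lemma bits_pop x i l :
  uniq (i :: l) -> (forall j, testbit x j = (j \in i :: l)) ->
  forall j, testbit (PeanoNat.Nat.lxor x (2 ^ i)) j = (j \in l).
Proof.
move=> /= /andP[il _] bx j.
rewrite PeanoNat.Nat.lxor_spec bx inE -{1}[2 ^ i]mul1n (testbit_pow2 true) /=.
by case: eqP => [->|_] /=; [rewrite (negPf il) | case: (j \in l)].
Qed.

(** * Reasoning about word RAM programs *)

(** Registers are given by a finite list, with 0 beyond it by the default of [nth]. Assignments
    become [set_nth], which allows symbolic execution. *)
Definition mk (l : seq nat) (A : nat -> nat -> nat) (T : nat -> pred nat) : state :=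
  State (nth 0 l) A T.

Lemma set_reg_mk l A T x v : set_reg (mk l A T) x v = mk (set_nth 0 l x v) A T.
Proof.
congr State; apply: functional_extensionality => y.
by rewrite /upd nth_set_nth /=.
Qed.

(* An upper bound on the running time of a command without loops. *)
Fixpoint ccost (c : cmd) : nat :=
  match c with
  | Skip => 1
  | Assign _ e | Insert _ e => (ecost e).+1
  | Write _ e1 e2 => (ecost e1 + ecost e2).+1
  | Seq c1 c2 => ccost c1 + ccost c2
  | If e c1 c2 => (ecost e + maxn (ccost c1) (ccost c2)).+1
  | While e _ => (ecost e).+1
  end.

Section Rules.

Variable w : nat.

Lemma cw_weaken c s (P Q : state -> Prop) T T' :
  computes_within c w s P T -> (forall s', P s' -> Q s') -> T <= T' ->
  computes_within c w s Q T'.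
Proof.
case=> t [s' [ex ps le]] PQ leT; exists t, s'; split=> //; first exact: PQ.
exact: leq_trans leT.
Qed.

Lemma cw_le c s (Q : state -> Prop) T T' :
  computes_within c w s Q T -> T <= T' -> computes_within c w s Q T'.
Proof. by move=> cw leT; apply: cw_weaken cw _ leT. Qed.

Lemma cw_seq c1 c2 s (P Q : state -> Prop) T1 T2 :
  computes_within c1 w s P T1 ->
  (forall s', P s' -> computes_within c2 w s' Q T2) ->
  computes_within (Seq c1 c2) w s Q (T1 + T2).
Proof.
case=> t1 [s1 [ex1 p1 le1]] /(_ _ p1)[t2 [s2 [ex2 p2 le2]]].
by exists (t1 + t2), s2; split; [exact: exec_seq ex1 ex2 | | exact: leq_add].
Qed.

Lemma cw_skip s (Q : state -> Prop) : Q s -> computes_within Skip w s Q 1.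
Proof. by move=> q; exists 1, s; split=> //; constructor. Qed.

Lemma cw_assign1 x e l A T v (Q : state -> Prop) :
  eval w (mk l A T) e = v -> Q (mk (set_nth 0 l x v) A T) ->
  computes_within (Assign x e) w (mk l A T) Q (ecost e).+1.
Proof.
move=> <- q; exists (ecost e).+1, (set_reg (mk l A T) x (eval w (mk l A T) e)).
by split=> //; [constructor | rewrite set_reg_mk].
Qed.

(** The form with a continuation lets a proof follow a program instruction by instruction, naming
    each computed value [v]. *)
Lemma cw_assign x e c l A T v (Q : state -> Prop) U :
  eval w (mk l A T) e = v -> computes_within c w (mk (set_nth 0 l x v) A T) Q U ->
  computes_within (Seq (Assign x e) c) w (mk l A T) Q ((ecost e).+1 + U).
Proof.
move=> ev q; apply: (cw_seq (P := eq (mk (set_nth 0 l x v) A T))) => [|_ <- //].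
exact: cw_assign1 ev _.
Qed.

Lemma cw_write1 X e1 e2 l A T i v (Q : state -> Prop) :
  eval w (mk l A T) e1 = i -> eval w (mk l A T) e2 = v ->
  Q (mk l (upd A X (upd (A X) i v)) T) ->
  computes_within (Write X e1 e2) w (mk l A T) Q (ecost e1 + ecost e2).+1.
Proof.
move=> <- <- q; exists (ecost e1 + ecost e2).+1, (mk l (upd A X (upd (A X)
  (eval w (mk l A T) e1) (eval w (mk l A T) e2))) T).
by split=> //; constructor.
Qed.

Lemma cw_write X e1 e2 c l A T i v (Q : state -> Prop) U :
  eval w (mk l A T) e1 = i -> eval w (mk l A T) e2 = v ->
  computes_within c w (mk l (upd A X (upd (A X) i v)) T) Q U ->
  computes_within (Seq (Write X e1 e2) c) w (mk l A T) Q ((ecost e1 + ecost e2).+1 + U).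
Proof.
move=> ev1 ev2 q.
apply: (cw_seq (P := eq (mk l (upd A X (upd (A X) i v)) T))) => [|_ <- //].
exact: cw_write1 ev1 ev2 _.
Qed.

Lemma cw_if e c1 c2 s (Q : state -> Prop) (c : bool) U :
  eval w s e = c -> computes_within (if c then c1 else c2) w s Q U ->
  computes_within (If e c1 c2) w s Q (ecost e + U).+1.
Proof.
move=> ev [t [s' [ex q le]]]; exists (ecost e + t).+1, s'; split=> //.
  by case: c ev ex => ev ex; [apply: exec_if_true | apply: exec_if_false]; rewrite ?ev.
by rewrite ltnS leq_add2l.
Qed.

Lemma cw_while_stop e c s (Q : state -> Prop) :
  eval w s e = 0 -> Q s -> computes_within (While e c) w s Q (ecost e).+1.
Proof. by move=> ev q; exists (ecost e).+1, s; split=> //; exact: exec_while_false. Qed.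

Lemma cw_while_step e c s (P Q : state -> Prop) T1 T2 :
  eval w s e != 0 -> computes_within c w s P T1 ->
  (forall s', P s' -> computes_within (While e c) w s' Q T2) ->
  computes_within (While e c) w s Q ((ecost e).+1 + T1 + T2).
Proof.
move=> ev [t1 [s1 [ex1 p1 le1]]] /(_ _ p1)[t2 [s2 [ex2 p2 le2]]].
exists (ecost e + t1 + t2).+1, s2; split=> //; first exact: exec_while_true ex1 ex2.
by rewrite -!addSn leq_add // leq_add2l.
Qed.

(** [I i] describes the state after [i] rounds, and each round has its own budget, which permits
    amortized bounds. The induction is on the number of remaining rounds. *)
Lemma cw_while (I : nat -> state -> Prop) (T : nat -> nat) N e c s :
  (forall i s, i < N -> I i s ->
     eval w s e != 0 /\ computes_within c w s (I i.+1) (T i)) ->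
  (forall s, I N s -> eval w s e = 0) -> I 0 s ->
  computes_within (While e c) w s (I N)
    (\sum_(i < N) (T i + (ecost e).+1) + (ecost e).+1).
Proof.
move=> step stop I0; rewrite -(big_mkord predT (fun i => T i + (ecost e).+1)).
have: forall d i s, i + d = N -> I i s ->
    computes_within (While e c) w s (I N)
      (\sum_(i <= i < N) (T i + (ecost e).+1) + (ecost e).+1).
  elim=> [|d IH] i s' eqN Ii.
    rewrite addn0 in eqN; subst i; rewrite big_geq // add0n.
    by apply: cw_while_stop => //; exact: stop.
  have ltN : i < N by rewrite -eqN addnS ltnS leq_addr.
  have [ev body] := step _ _ ltN Ii.
  rewrite big_ltn // [T i + _]addnC -addnA.
  apply: cw_while_step ev body _ => s2 Is2.
  by apply: IH => //; rewrite addSnnS.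
by move=> /(_ N 0 s); apply.
Qed.

Lemma cw_while_const (I : nat -> state -> Prop) U N e c s :
  (forall i s, i < N -> I i s ->
     eval w s e != 0 /\ computes_within c w s (I i.+1) U) ->
  (forall s, I N s -> eval w s e = 0) -> I 0 s ->
  computes_within (While e c) w s (I N)
    (N * (U + (ecost e).+1) + (ecost e).+1).
Proof.
move=> step stop I0; apply: cw_weaken (cw_while (T := fun=> U) step stop I0) _ _ => //.
by rewrite sum_nat_const card_ord.
Qed.

End Rules.

(** * Positions of the largest letters *)

Definition top_positions (k : nat) (t : seq nat) : seq nat :=
  [seq index (size t - l) t | l <- iota 0 (minn k (size t))].

(* What the queue stores about t: the position of its largest letter, and the
   positions of the next letters before that letter was inserted. *)
Definition feed (k : nat) (t : seq nat) : seq nat :=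
  index (size t) t :: top_positions k (rem (size t) t).

Lemma size_top_positions k t : size (top_positions k t) = minn k (size t).
Proof. by rewrite size_map size_iota. Qed.

Lemma nth_top_positions k t l :
  l < minn k (size t) -> nth 0 (top_positions k t) l = index (size t - l) t.
Proof. by move=> lt; rewrite (nth_map 0) ?size_iota // nth_iota. Qed.

Lemma feed_ins k m t i :
  is_perm m t -> i <= m -> feed k (ins t i m.+1) = i :: top_positions k t.
Proof.
move=> pt im; have [_ st _] := is_permP pt.
have mt : m.+1 \notin t by rewrite (mem_is_perm _ pt) ltnn.
by rewrite /feed size_ins st index_ins ?st // rem_ins.
Qed.

Lemma size_rem_max m t : is_perm m.+1 t -> size (rem m.+1 t) = m.
Proof.
move=> pt; have [_ st _] := is_permP pt.
by rewrite size_rem ?st // (mem_is_perm _ pt); lia.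
Qed.

(** Entries after the first were measured in the parent of [t]; inserting [m] moves such a position
    to the right unless it is before the insertion point. The first entry is the place of [m] itself
    and needs no correction. *)
Lemma nth_feed k m t l : is_perm m t -> l < minn k m ->
  index (m - l) t = nth 0 (feed k t) l + ((0 < l) && (index m t <= nth 0 (feed k t) l)).
Proof.
case: m => [|m] pt; first by rewrite minn0.
have [ut st _] := is_permP pt; rewrite /feed st.
case: l => [|l] lt; first by rewrite subn0 /= addn0.
have sr := size_rem_max pt.
have mt : m.+1 \in t by rewrite (mem_is_perm _ pt); lia.
rewrite /= nth_top_positions sr; last by lia.
rewrite -[t in LHS](ins_index_rem mt) subSS index_ins_neq //.
- by rewrite mem_rem_uniq // inE (mem_is_perm _ pt); apply/andP; split; [apply/eqP|]; lia.
- by apply/eqP; lia.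
- by rewrite sr -ltnS -{2}st index_mem.
Qed.

Lemma size_feed k m t : is_perm m t -> minn k m <= size (feed k t).
Proof.
case: m => [|m] pt; first by rewrite minn0.
have [_ st _] := is_permP pt.
by rewrite /= size_top_positions st size_rem_max //; lia.
Qed.

(** * The program *)

Local Notation "x [+] y" := (Binop Add x y) (at level 50, left associativity).
Local Notation "x [-] y" := (Binop Defs.Sub x y) (at level 50, left associativity).
Local Notation "x [*] y" := (Binop Mul x y) (at level 40, left associativity).
Local Notation "x [%] y" := (Binop Mod x y) (at level 40, left associativity).
Local Notation "x [&] y" := (Binop And x y) (at level 40, left associativity).
Local Notation "x [or] y" := (Binop Or x y) (at level 50, left associativity).
Local Notation "x [^] y" := (Binop Xor x y) (at level 50, left associativity).
Local Notation "x [<<] y" := (Binop Shl x y) (at level 50, left associativity).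
Local Notation "x [>>] y" := (Binop Shr x y) (at level 50, left associativity).
Local Notation "x [=] y" := (Binop Eqw x y) (at level 70, no associativity).
Local Notation "x [<] y" := (Binop Ltw x y) (at level 70, no associativity).
Local Notation "c1 ;; c2" := (Seq c1 c2) (at level 90, right associativity).
Local Notation "x ::= e" := (Assign x e) (at level 80).

(* rm is the length of the current word, whose code is in rcur; rE is its bit map,
   rpos its packed positions, and rD its code with all letters above m - ri
   lowered by one. *)
Local Notation rn := 0 (only parsing).
Local Notation rk := 1 (only parsing).
Local Notation rb := 2 (only parsing).
Local Notation rlim := 3 (only parsing).
Local Notation rm := 4 (only parsing).
Local Notation rtail := 5 (only parsing).
Local Notation rhead := 6 (only parsing).
Local Notation rend := 7 (only parsing).
Local Notation rcur := 8 (only parsing).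
Local Notation rfeed := 9 (only parsing).
Local Notation rE := 10 (only parsing).
Local Notation ri := 11 (only parsing).
Local Notation rD := 12 (only parsing).
Local Notation rpos := 13 (only parsing).
Local Notation ri0 := 14 (only parsing).
Local Notation rp := 15 (only parsing).
Local Notation rbp := 16 (only parsing).
Local Notation re := 17 (only parsing).

(* aext is indexed by the code of a word, afeed by its place in the queue. *)
Local Notation aext := 2 (only parsing).
Local Notation afeed := 3 (only parsing).

(* The code of the word obtained by inserting m + 1 into the current word at the
   position p with b * p in register rbp. *)
Definition child_code : expr :=
  (Reg rcur [%] (Const 1 [<<] Reg rbp)) [+] ((Reg rm [+] Const 1) [<<] Reg rbp)
  [+] ((Reg rcur [>>] Reg rbp) [<<] (Reg rbp [+] Reg rb)).

Definition filter_body : cmd :=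
  rbp ::= Reg rb [*] Reg ri ;;
  rE ::= Reg rE [or] ((Member 0 child_code [=] Const 0) [<<] Reg ri) ;;
  ri ::= Reg ri [+] Const 1.

Definition filter_patterns : cmd :=
  ri ::= Const 0 ;;
  rE ::= Const 0 ;;
  While (Reg ri [<] (Reg rm [+] Const 1)) filter_body.

(** The round for the letter [m - ri]: take its position from the front of the feed and correct it,
    append it to [rpos], look up the bit map of the word without this letter, double one bit,
    intersect with [rE], and prepare [rD] for the next letter. *)
Definition delete_body : cmd :=
  rp ::= Reg rfeed [%] (Const 1 [<<] Reg rb) ;;
  rp ::= Reg rp [+] ((Const 0 [<] Reg ri) [&] ((Reg rp [<] Reg ri0) [=] Const 0)) ;;
  rfeed ::= Reg rfeed [>>] Reg rb ;;
  rbp ::= Reg rb [*] Reg rp ;;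
  rpos ::= Reg rpos [+] (Reg rp [<<] (Reg rb [*] Reg ri)) ;;
  re ::= Read aext ((Reg rD [%] (Const 1 [<<] Reg rbp))
                   [+] ((Reg rD [>>] (Reg rbp [+] Reg rb)) [<<] Reg rbp)) ;;
  rE ::= Reg rE [&] ((Reg re [%] (Const 1 [<<] (Reg rp [+] Const 1)))
                    [+] ((Reg re [>>] Reg rp) [<<] (Reg rp [+] Const 1))) ;;
  rD ::= Reg rD [-] (Const 1 [<<] Reg rbp) ;;
  ri ::= Reg ri [+] Const 1.

Definition delete_letters : cmd :=
  rD ::= Reg rcur ;;
  rpos ::= Const 0 ;;
  ri ::= Const 0 ;;
  ri0 ::= Reg rfeed [%] (Const 1 [<<] Reg rb) ;;
  While ((Reg ri [<] Reg rk) [&] (Reg ri [<] Reg rm)) delete_body.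

(** The lowest set bit is the next insertion position. The feed of the child is this position
    followed by the positions packed for the parent. *)
Definition emit_body (aq : nat) : cmd :=
  ri ::= Unop Ctz (Reg rE) ;;
  rE ::= Reg rE [^] (Const 1 [<<] Reg ri) ;;
  rbp ::= Reg rb [*] Reg ri ;;
  Write aq (Reg rtail) child_code ;;
  Write afeed (Reg rtail) (Reg ri [+] (Reg rpos [<<] Reg rb)) ;;
  rtail ::= Reg rtail [+] Const 1.

Definition emit (aq ac : nat) : cmd :=
  Write aext (Reg rcur) (Reg rE) ;;
  Write ac (Reg rm [+] Const 1)
        (Read ac (Reg rm [+] Const 1) [+] Unop Popcount (Reg rE)) ;;
  If (Reg rm [<] Reg rlim) (While (Reg rE) (emit_body aq)) Skip.

(** Once the current word has at least [k] letters, a child is too long to be a pattern, so all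
    [m + 1] bits start as 1. *)
Definition process (aq ac : nat) : cmd :=
  If (Reg rm [<] Reg rk) filter_patterns
     (rE ::= (Const 1 [<<] (Reg rm [+] Const 1)) [-] Const 1) ;;
  delete_letters ;;
  emit aq ac.

Definition level_body (aq ac : nat) : cmd :=
  rcur ::= Read aq (Reg rhead) ;;
  rfeed ::= Read afeed (Reg rhead) ;;
  process aq ac ;;
  rhead ::= Reg rhead [+] Const 1.

(** [rend] freezes the end of the current level, since the queue grows while the level is
    processed. *)
Definition next_level (aq ac : nat) : cmd :=
  rend ::= Reg rtail ;;
  While (Reg rhead [<] Reg rend) (level_body aq ac) ;;
  rm ::= Reg rm [+] Const 1.

(* [aq] is the array of the queue, [ac] that of the counts; words of length at
   most n - d are put in the queue. *)
Definition enumerate (aq ac d : nat) : cmd :=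
  rlim ::= Reg rn [-] Const d ;;
  process aq ac ;;
  rm ::= Const 1 ;;
  While ((Reg rhead [<] Reg rtail) [&] (Reg rm [<] Reg rn)) (next_level aq ac).

(** * Correctness and cost of filtering and of deleting letters *)

Section Correctness.

Variables (Pi : seq (seq nat)) (n b w : nat).
Hypothesis pPi : pattern_set Pi.
Hypothesis n_gt0 : 0 < n.
Hypothesis ok : word_size_ok n (max_length Pi) b w.

Local Notation k := (max_length Pi).
Let tables : nat -> pred nat := tabs (input n b Pi).

Lemma n_ltb : n < 2 ^ b. Proof. by case/and4P: ok. Qed.
Lemma nb_lew : b * n <= w. Proof. by rewrite mulnC; case/and4P: ok. Qed.
Lemma n_ltw : n < w. Proof. by case/and4P: ok. Qed.

Lemma b_gt0 : 0 < b.
Proof. by have := n_ltb; case: b => // ; rewrite expn0; lia. Qed.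

Lemma k_gt0 : 0 < k.
Proof.
case/andP: pPi; case E : Pi => [|p s] // _ /= /andP[/andP[p0 _] _].
by rewrite /max_length big_cons leq_max p0.
Qed.

Lemma mul_b_lew i : i <= n -> b * i <= w.
Proof. by move=> le; apply: leq_trans nb_lew; rewrite leq_mul2l le orbT. Qed.

Lemma mul_b_ltw i : i < n -> b * i < w.
Proof. by move=> lt; have := mul_b_lew lt; have := b_gt0; rewrite mulnS; lia. Qed.

Lemma word_small x : x <= w -> x %% 2 ^ w = x.
Proof. by move=> le; rewrite modn_small // (leq_ltn_trans le) // ltn_expl. Qed.

Lemma const1 : 1 %% 2 ^ w = 1.
Proof. by rewrite word_small //; have := n_ltw; lia. Qed.

Lemma shl1 e : e < w -> (1 %% 2 ^ w * 2 ^ e) %% 2 ^ w = 2 ^ e.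
Proof. by move=> lt; rewrite const1 mul1n modn_small // ltn_exp2l. Qed.

Lemma succ_word x : x < w -> (x + 1 %% 2 ^ w) %% 2 ^ w = x.+1.
Proof. by move=> lt; rewrite const1 addn1 word_small. Qed.

Lemma pow_lew x e : e <= n -> x < 2 ^ (b * e) -> x < 2 ^ w.
Proof. by move=> le lt; apply: leq_trans lt _; rewrite leq_exp2l // mul_b_lew. Qed.

Lemma letters_lt m t : is_perm m t -> m <= n -> all (fun x => 0 < x < 2 ^ b) t.
Proof.
move=> pt mn; apply/allP=> x; rewrite (mem_is_perm _ pt) => /andP[-> xm].
by rewrite (leq_ltn_trans _ n_ltb) // (leq_trans xm).
Qed.

Lemma all_lt m t : is_perm m t -> m <= n -> all (fun x => x < 2 ^ b) t.
Proof. by move=> pt mn; apply: sub_all (letters_lt pt mn) => x /andP[]. Qed.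

Lemma code_perm_lt m t : is_perm m t -> m <= n -> code b t < 2 ^ (b * m).
Proof.
by move=> pt mn; have [_ {2}<- _] := is_permP pt; exact: code_lt (all_lt pt mn).
Qed.

Lemma code_perm_inj m1 m2 t1 t2 :
  is_perm m1 t1 -> is_perm m2 t2 -> m1 <= n -> m2 <= n ->
  code b t1 = code b t2 -> t1 = t2.
Proof. by move=> p1 p2 l1 l2; apply: code_inj; [exact: letters_lt l1 | exact: letters_lt l2]. Qed.

(** Patterns longer than [n] are not stored, but [t] is none of them; for stored patterns equal
    codes mean equal words. *)
Lemma mem_tables m t : is_perm m t -> m <= n -> tables 0 (code b t) = (t \in Pi).
Proof.
move=> pt mn; have [_ st _] := is_permP pt; rewrite /tables /= ?eqxx /=.
apply/mapP/idP => [[p]|tPi]; last first.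
  by exists t => //; rewrite mem_filter tPi st mn.
rewrite mem_filter => /andP[pn pp] eqc.
have /andP[_ /allP/(_ _ pp)/andP[_ permp]] := pPi.
by rewrite (code_perm_inj pt permp mn pn eqc).
Qed.

(** Nothing overflows: the three parts add up to the code of the child, which fits in a word, so
    each part does. *)
Lemma eval_child s m t i :
  is_perm m t -> m < n -> i <= m ->
  regs s rcur = code b t -> regs s rm = m -> regs s rb = b -> regs s rbp = b * i ->
  eval w s child_code = code b (ins t i m.+1).
Proof.
move=> pt mn im rc rm_ rb_ rbp_.
rewrite /child_code /= rc rm_ rb_ rbp_.
have [_ st _] := is_permP pt; have := n_ltw => nw.
rewrite shl1 ?mul_b_ltw ?(leq_ltn_trans im) // succ_word; last by lia.
rewrite [(b * i + b) %% _]word_small; last first.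
  have bim : b * i <= b * m by rewrite leq_mul2l im orbT.
  by have := mul_b_lew mn; rewrite mulnS; lia.
have : code b (ins t i m.+1) < 2 ^ w.
  exact: pow_lew mn (code_perm_lt (is_perm_ins i pt) mn).
rewrite code_ins ?st ?(all_lt pt) ?(ltnW mn) //.
move: (_ %% 2 ^ (b * i)) (_ * 2 ^ (b * i)) (_ * 2 ^ (b * i + b)) => x y z lt.
by rewrite !modn_small //; lia.
Qed.

Lemma ecost_child : ecost child_code = 19. Proof. by []. Qed.

Local Opaque child_code.

Lemma filter_ok m t A lim tail head lend F jE ji jD jpos ji0 jp jbp je :
  is_perm m t -> m < n ->
  computes_within filter_patterns w
    (mk [:: n; k; b; lim; m; tail; head; lend; code b t; F; jE; ji; jD; jpos; ji0; jp; jbp; je]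
        A tables)
    (fun s => exists E i bp,
       s = mk [:: n; k; b; lim; m; tail; head; lend; code b t; F; E; i; jD; jpos; ji0; jp; bp; je]
              A tables
       /\ forall j, testbit E j = (j <= m) && (ins t j m.+1 \notin Pi))
    (45 * m.+1 + 20).
Proof.
move=> pt mn; have nw := n_ltw.
(* The bits below [i] are decided; all others are still 0. *)
pose I i s := exists E bp,
  s = mk [:: n; k; b; lim; m; tail; head; lend; code b t; F; E; i; jD; jpos; ji0; jp; bp; je]
         A tables
  /\ forall j, testbit E j = (j < i) && (ins t j m.+1 \notin Pi).
have loop s : I 0 s -> computes_within
    (While (Reg ri [<] (Reg rm [+] Const 1)) filter_body) w s (I m.+1)
    (m.+1 * (ccost filter_body + 6) + 6).
  apply: cw_while_const => [i {}s lt [E [bp [-> bits]]]|{}s [E [bp [-> bits]]]]; last first.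
    by rewrite /= succ_word ?ltnn //; lia.
  split; first by rewrite /= succ_word ?lt //; lia.
  apply: (cw_assign (v := b * i)).
    by rewrite /= word_small // mul_b_lew; lia.
  apply: (cw_assign (v := PeanoNat.Nat.lor E ((ins t i m.+1 \notin Pi) * 2 ^ i))).
    rewrite /= (eval_child (i := i) pt) // (mem_tables (is_perm_ins i pt)) // mod0n.
    congr PeanoNat.Nat.lor; rewrite modn_small; first by case: (_ \in _).
    by apply: leq_ltn_trans (_ : 2 ^ i < 2 ^ w); [case: (_ \in _) => /=; lia | rewrite ltn_exp2l //; lia].
  apply: (cw_assign1 (v := i.+1)); first by rewrite /= succ_word //; lia.
  do 2!eexists; split; first by [].
  move=> j; rewrite PeanoNat.Nat.lor_spec bits testbit_pow2 ltnS [j <= i]leq_eqVlt.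
  by case: eqP => [->|_]; rewrite ?ltnn ?andbT ?andbF ?orbF.
apply: cw_weaken.
- apply: (cw_assign (v := 0)); first by rewrite /= mod0n.
  apply: (cw_assign (v := 0)); first by rewrite /= mod0n.
  by apply: loop; do 2!eexists; split=> // j; rewrite testbit0.
- by move=> s [E [bp [-> bits]]]; do 3!eexists; split; first by [].
- by rewrite /= ecost_child; lia.
Qed.

Lemma all_positions t :
  size t <= n -> all (fun x => x < 2 ^ b) (top_positions k t).
Proof.
move=> tn; apply/allP=> _ /mapP[l _ ->].
exact: leq_ltn_trans (leq_trans (index_size _ _) tn) n_ltb.
Qed.

Lemma all_feed m t :
  is_perm m t -> m <= n -> all (fun x => x < 2 ^ b) (feed k t).
Proof.
move=> pt mn; have [_ st _] := is_permP pt.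
rewrite /= all_positions.
  by rewrite andbT (leq_ltn_trans _ n_ltb) // (leq_trans (index_size _ _)) ?st.
by apply: leq_trans mn; rewrite -[X in _ <= X]st size_subseq // rem_subseq.
Qed.

Lemma delete_ok m t A lim tail head lend E0 ji jD jpos ji0 jp jbp je :
  is_perm m t -> m < n ->
  (forall l, l < minn k m -> forall i,
     testbit (A aext (code b (del (m - l) t))) i =
     (i < m) && avoids Pi (ins (del (m - l) t) i m)) ->
  computes_within delete_letters w
    (mk [:: n; k; b; lim; m; tail; head; lend; code b t; code b (feed k t); E0;
            ji; jD; jpos; ji0; jp; jbp; je] A tables)
    (fun s => exists F E i D i0 p bp e,
       s = mk [:: n; k; b; lim; m; tail; head; lend; code b t; F; E;
                  i; D; code b (top_positions k t); i0; p; bp; e] A tables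
       /\ forall i, testbit E i = testbit E0 i &&
            all (fun l => let i' := i - (index (m - l) t < i) in
                   (i' < m) && avoids Pi (ins (del (m - l) t) i' m))
                (iota 0 (minn k m)))
    (100 * minn k m + 30).
Proof.
move=> pt mn ext; have nw := n_ltw; have [ut st _] := is_permP pt.
have lt_bits := all_lt pt (ltnW mn).
(* For n = 1 the width b may be w, and then 1 << b wraps to 0; but then m = 0 and
   the loop is not entered. *)
set i0v := code b (feed k t) %% (2 ^ b %% 2 ^ w).
pose P i l := let i' := i - (index (m - l) t < i) in
  (i' < m) && avoids Pi (ins (del (m - l) t) i' m).
(* After [l] rounds, [l] blocks of the feed are consumed, [l] positions are packed, the letters
   above [m - l] are lowered, and the maps of the first [l] deletions are intersected. *)
pose I l s := exists E p bp e,
  s = mk [:: n; k; b; lim; m; tail; head; lend; code b t; code b (drop l (feed k t)); E;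
             l; code b (map (lower (m - l)) t); code b (take l (top_positions k t));
             i0v; p; bp; e] A tables
  /\ forall i, testbit E i = testbit E0 i && all (P i) (iota 0 l).
have loop s : I 0 s -> computes_within
    (While ((Reg ri [<] Reg rk) [&] (Reg ri [<] Reg rm)) delete_body) w s (I (minn k m))
    (minn k m * (ccost delete_body + 8) + 8).
  apply: cw_while_const => [l {}s lt [E [p [bp [e [-> bits]]]]]|{}s [E [p [bp [e [-> bits]]]]]];
    last by rewrite /= land_bool -leq_min ltnn.
  have [lk lm] : l < k /\ l < m by move: lt; rewrite leq_min => /andP.
  split; first by rewrite /= land_bool lk lm.
  set j := m - l; have jt : j \in t by rewrite (mem_is_perm _ pt) /j; lia.
  set q := index j t; have qm : q < m by rewrite -st index_mem.
  have mw : m.+2 <= w by exact: leq_ltn_trans nw.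
  have lw : l < w by apply: leq_trans (ltnW mw); exact: ltnW.
  have qw : q.+1 < w by exact: leq_ltn_trans (ltnW mw).
  have mPn : m.-1 <= n by rewrite (leq_trans (leq_pred _)) // ltnW.
  have lSn : l.+1 <= n by exact: ltn_trans mn.
  have jp0 : 0 < j by rewrite /j subn_gt0.
  have jE : m - l.+1 = j.-1 by rewrite /j subnS.
  have bl_w : b * l <= w by apply/ltnW/mul_b_ltw; exact: ltn_trans mn.
  have bq_w : b * q < w by apply: mul_b_ltw; exact: ltn_trans mn.
  have bqS_w : b * q + b <= w.
    by rewrite -mulnSr; apply/ltnW/mul_b_ltw; exact: leq_ltn_trans mn.
  have b_w : b < w.
    by rewrite -[b]muln1; apply: mul_b_ltw; apply: leq_ltn_trans mn; exact: leq_ltn_trans lm.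
  have w1 : 2 ^ b %% 2 ^ w = 2 ^ b by rewrite modn_small // ltn_exp2l.
  set x := nth 0 (feed k t) l.
  have lf : l < size (feed k t) by apply: leq_trans (size_feed k pt).
  have dropE : drop l (feed k t) = x :: drop l.+1 (feed k t) by rewrite (drop_nth 0).
  have feed_lt := all_feed pt (ltnW mn).
  have x_lt : x < 2 ^ b by apply: (allP feed_lt); exact: mem_nth.
  have i0E : i0v = index m t.
    rewrite /i0v w1 /feed code_cons modnMDr modn_small st //.
    by apply: (allP feed_lt); rewrite /feed st mem_head.
  have qE : q = x + ((0 < l) && (index m t <= x)) by exact: nth_feed.
  set D := map (lower j) t.
  have D_lt : all (fun y => y < 2 ^ b) D.
    apply/allP=> _ /mapP[y yt ->]; apply: leq_ltn_trans (allP lt_bits _ yt).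
    by rewrite /lower leq_subr.
  have sD : size D = m by rewrite size_map.
  have delE : take q D ++ drop q.+1 D = del j t.
    by rewrite /del remE map_cat map_take map_drop.
  have permd := is_perm_del pt jt.
  set e1 := A aext (code b (del j t)).
  have e1_lt : e1 < 2 ^ m by apply: bits_lt => i mi; rewrite ext // ltnNge mi.
  apply: (cw_assign (v := x)).
    by rewrite /= shl1 // dropE code_cons modnMDr modn_small.
  (* The added bit is the correction of [nth_feed]. *)
  apply: (cw_assign (v := q)).
    by rewrite /= mod0n eqb0 -leqNgt i0E land_bool -qE word_small // ltnW // ltnW.
  apply: (cw_assign (v := code b (drop l.+1 (feed k t)))).
    by rewrite /= dropE code_cons divnMDr ?expn_gt0 // divn_small.
  apply: (cw_assign (v := b * q)); first by rewrite /= word_small // ltnW.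
  apply: (cw_assign (v := code b (take l.+1 (top_positions k t)))).
    have lp : l < size (top_positions k t) by rewrite size_top_positions st.
    rewrite /= [(b * l) %% _]word_small //.
    have cE : code b (take l.+1 (top_positions k t)) =
        code b (take l (top_positions k t)) + q * 2 ^ (b * l).
      rewrite (take_nth 0) // -cats1 code_cat size_takel ?(ltnW lp) //.
      by rewrite code_cons code_nil mul0n addn0 nth_top_positions st.
    have : code b (take l.+1 (top_positions k t)) < 2 ^ w.
      apply: (@pow_lew _ l.+1) => //.
      by apply: code_take_lt => //; apply: all_positions; rewrite st ltnW.
    rewrite cE => ltw; rewrite [q * _ %% _]modn_small ?modn_small //.
    exact: leq_ltn_trans (leq_addl _ _) ltw.
  apply: (cw_assign (v := e1)).
    rewrite /= shl1 // [(b * q + b) %% _]word_small //.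
    have cE := code_remove D_lt (_ : q < size D).
    have := cE (eq_ind_r (fun y => q < y) qm sD); rewrite delE => {}cE.
    have : code b (del j t) < 2 ^ w.
      by apply: (@pow_lew _ m.-1) => //; exact: code_perm_lt.
    rewrite cE => ltw; rewrite /e1 cE; congr (A _ _).
    move: ltw; move: (_ %% 2 ^ (b * q)) (_ * 2 ^ (b * q)) => y z ltw.
    by clear - ltw; rewrite !modn_small //; lia.
  apply: (cw_assign (v := PeanoNat.Nat.land E (e1 %% 2 ^ q.+1 + e1 %/ 2 ^ q * 2 ^ q.+1))).
    rewrite /= succ_word; last exact: ltnW.
    rewrite shl1 //.
    (* The doubled map is at most [3 * e1], which is below [2 ^ (m + 2)], and [m + 2 <= w]; so
       neither the shift nor the sum wraps around. *)
    have lt1 : e1 %/ 2 ^ q * 2 ^ q.+1 <= 2 * e1.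
      by rewrite expnS mulnCA leq_mul2l leq_divM.
    have lt2 : e1 %% 2 ^ q.+1 <= e1 by exact: leq_mod.
    have lt3 : 2 ^ m.+2 <= 2 ^ w by rewrite leq_exp2l.
    have lt4 : 3 * e1 < 2 ^ w by apply: leq_trans lt3; rewrite !expnS; clear - e1_lt; lia.
    congr PeanoNat.Nat.land.
    move: lt1 lt2; move: (_ %% 2 ^ q.+1) (_ * 2 ^ q.+1) => y z lt1 lt2.
    by clear - lt1 lt2 lt4; rewrite !modn_small //; lia.
  apply: (cw_assign (v := code b (map (lower (m - l.+1)) t))).
    have D_w : code b D < 2 ^ w.
      by apply: (@pow_lew _ m); [exact: ltnW | rewrite -{1}sD code_lt].
    rewrite /= shl1 //.
    (* The subtrahend is a summand of the code, so the modular subtraction is exact. *)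
    have cE : code b D = code b (map (lower j.-1) t) + 2 ^ (b * q) by exact: code_lower.
    rewrite jE; move: D_w; rewrite cE => D_w.
    have lt1 : 2 ^ (b * q) <= 2 ^ w by rewrite leq_exp2l // ltnW.
    rewrite -addnA subnKC // modnDr modn_small //.
    exact: leq_ltn_trans (leq_addr _ _) D_w.
  apply: (cw_assign1 (v := l.+1)); first by rewrite /= succ_word.
  do 4!eexists; split; first by [].
  move=> i; rewrite PeanoNat.Nat.land_spec bits testbit_shift ext // -(addn1 l) iotaD all_cat /=.
  by rewrite andbT -andbA add0n.
apply: cw_weaken.
- apply: (cw_assign (v := code b t)); first by [].
  apply: (cw_assign (v := 0)); first by rewrite /= mod0n.
  apply: (cw_assign (v := 0)); first by rewrite /= mod0n.
  apply: (cw_assign (v := i0v)); first by rewrite /= const1 mul1n.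
  apply: loop; do 4!eexists; split; last by move=> i; rewrite andbT.
  (* [lower m] fixes all letters of [t], so the code of [t] itself starts the invariant. *)
  rewrite drop0 take0 code_nil subn0; congr (mk [:: _, _, _, _, _, _, _, _, _, _, _, _, code b _ & _] _ _).
  rewrite -[LHS]map_id; apply/eq_in_map => y.
  by rewrite (mem_is_perm _ pt) /lower; lia.
- move=> s [E [p [bp [e [-> bits]]]]]; do 8!eexists; split; last exact: bits.
  by rewrite [take _ _]take_oversize // size_top_positions st.
- by rewrite /=; lia.
Qed.

(** * The queue and the children of a word *)

Variables aq ac : nat.
Hypothesis distinct_arrays : uniq [:: aq; ac; aext; afeed].

Lemma arrays_neq : [/\ aq != ac, aq != aext, aq != afeed, ac != aext & ac != afeed].
Proof.
move: distinct_arrays; rewrite /= !inE !negb_or -!andbA.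
by case/and5P=> qc q2 q3 c2 /andP[c3 _].
Qed.

Definition stored (A : nat -> nat -> nat) (q : seq (seq nat)) : Prop :=
  forall i, i < size q ->
    A aq i = code b (nth [::] q i) /\ A afeed i = code b (feed k (nth [::] q i)).

(** Children longer than [lim] are counted but not stored. *)
Definition enqueued (lim : nat) (t : seq nat) : seq (seq nat) :=
  if size t < lim then kids Pi t else [::].

Lemma stored_rcons A q t :
  stored A q ->
  stored (upd (upd A aq (upd (A aq) (size q) (code b t))) afeed
            (upd (upd A aq (upd (A aq) (size q) (code b t)) afeed) (size q)
               (code b (feed k t)))) (rcons q t).
Proof.
move=> st i; rewrite size_rcons ltnS leq_eqVlt nth_rcons /upd eqxx.
have [_ _ /negPf q3 _ _] := arrays_neq.
rewrite q3 [afeed == aq]eq_sym q3.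
by rewrite eqxx; case: (i =P size q) => [->|_ /= lt]; [rewrite ltnn | rewrite lt; exact: st].
Qed.

Lemma stored_upd A q X f : X != aq -> X != afeed -> stored A q -> stored (upd A X f) q.
Proof.
by move=> /negPf Xq /negPf Xf st i /st; rewrite /upd (eq_sym aq) (eq_sym afeed) Xq Xf.
Qed.

Lemma emit_ok m t A lim q head lend F E ji jD ji0 jp jbp je :
  is_perm m t -> m < n ->
  (forall i, testbit E i = (i <= m) && avoids Pi (ins t i m.+1)) ->
  stored A q -> size (q ++ enqueued lim t) < 2 ^ w ->
  A ac m.+1 + size (kids Pi t) < 2 ^ w ->
  computes_within (emit aq ac) w
    (mk [:: n; k; b; lim; m; size q; head; lend; code b t; F; E; ji; jD;
            code b (top_positions k t); ji0; jp; jbp; je] A tables)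
    (fun s => exists E' i bp A',
       [/\ s = mk [:: n; k; b; lim; m; size (q ++ enqueued lim t); head; lend; code b t; F; E';
                   i; jD; code b (top_positions k t); ji0; jp; bp; je] A' tables,
           stored A' (q ++ enqueued lim t),
           A' aext = upd (A aext) (code b t) E
         & A' ac = upd (A ac) m.+1 (A ac m.+1 + size (kids Pi t))])
    (80 * size (enqueued lim t) + 60).
Proof.
move=> pt mn bits stA ltq ltc; have nw := n_ltw; have [ut st _] := is_permP pt.
have [qc q2 q3 c2 c3] := arrays_neq.
(* [ms] lists the set bits of [E] in increasing order, hence the children in the order of [kids];
   its length is the popcount. *)
set ms := [seq i <- iota 0 m.+1 | avoids Pi (ins t i m.+1)].
have kidsE : kids Pi t = [seq ins t i m.+1 | i <- ms] by rewrite /kids st.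
have msm i : i \in ms -> i <= m by rewrite mem_filter mem_iota => /andP[_]; lia.
have bms i : testbit E i = (i \in ms).
  by rewrite bits mem_filter mem_iota andbC add0n ltnS leq0n.
have sms : sorted ltn ms by apply: sorted_filter (iota_ltn_sorted _ _); exact: ltn_trans.
have ums : uniq ms by rewrite filter_uniq ?iota_uniq.
set A1 := upd A aext (upd (A aext) (code b t) E).
set A2 := upd A1 ac (upd (A1 ac) m.+1 (A1 ac m.+1 + size (kids Pi t))).
have A1c : A1 ac = A ac by rewrite /A1 /upd (negPf c2).
have stA2 : stored A2 q.
  apply: stored_upd; [by rewrite eq_sym | by [] |].
  by apply: stored_upd => //; rewrite eq_sym.
have A2e : A2 aext = upd (A aext) (code b t) E.
  by rewrite /A2 /A1 /upd eq_sym (negPf c2) eqxx.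
have A2c : A2 ac = upd (A ac) m.+1 (A ac m.+1 + size (kids Pi t)).
  by rewrite /A2 /upd eqxx A1c.
apply: cw_le.
- apply: (cw_write (i := code b t) (v := E)) => //.
  apply: (cw_write (i := m.+1) (v := A1 ac m.+1 + size (kids Pi t))).
  + by rewrite /= succ_word //; lia.
  + rewrite /= succ_word; last by lia.
    rewrite (popcountE ums) //; last by move=> i /msm; lia.
    by rewrite -/A1 -(size_map (fun i => ins t i m.+1)) -kidsE modn_small // A1c.
  apply: (cw_if (c := m < lim) (U := 80 * size (enqueued lim t) + 30)) => //=.
  rewrite /enqueued st in ltq *; case: ifP ltq => [ml|_] ltq; last first.
    rewrite cats0; apply: cw_le (cw_skip _ _) _ => //.
    by exists E, ji, jbp, A2.
  (* After [r] rounds the [r] lowest bits are cleared and the corresponding children are stored. *)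
  pose I r s := exists E' i bp A',
    [/\ s = mk [:: n; k; b; lim; m; size q + r; head; lend; code b t; F; E';
                i; jD; code b (top_positions k t); ji0; jp; bp; je] A' tables,
        stored A' (q ++ [seq ins t i m.+1 | i <- take r ms]),
        (forall i, testbit E' i = (i \in drop r ms)), A' aext = A2 aext & A' ac = A2 ac].
  apply: cw_weaken.
  + apply: (cw_while_const (I := I) (N := size ms) (U := ccost (emit_body aq))).
    * move=> r s lt [E' [i [bp [A' [-> stA' bE Ae Ac]]]]].
      set i' := nth 0 ms r; have i'ms : i' \in ms by exact: mem_nth.
      have i'm := msm _ i'ms.
      have i'n : i' < n by exact: leq_ltn_trans mn.
      have i'w : i' < w by exact: ltn_trans nw.
      have dE : drop r ms = i' :: drop r.+1 ms by rewrite (drop_nth 0).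
      rewrite dE in bE.
      have sd : sorted ltn (i' :: drop r.+1 ms) by rewrite -dE drop_sorted.
      have ud : uniq (i' :: drop r.+1 ms) by rewrite -dE drop_uniq.
      set q' := q ++ [seq ins t j m.+1 | j <- take r ms].
      have sq' : size q' = size q + r by rewrite size_cat size_map size_takel // ltnW.
      set t' := ins t i' m.+1.
      have pt' : is_perm m.+1 t' by exact: is_perm_ins.
      split; first by apply/eqP=> /= E0; have := bE i'; rewrite E0 testbit0 mem_head.
      apply: (cw_assign (v := i')); first by rewrite /= (ctzE sd).
      apply: (cw_assign (v := PeanoNat.Nat.lxor E' (2 ^ i'))).
        by rewrite /= shl1.
      apply: (cw_assign (v := b * i')).
        by rewrite /= word_small // mul_b_lew // ltnW.
      apply: (cw_write (i := size q') (v := code b t')); first by rewrite sq'.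
        exact: eval_child.
      apply: (cw_write (i := size q') (v := code b (feed k t'))); first by rewrite sq'.
        have : code b (feed k t') < 2 ^ w.
          (* The feed of the child has at most [m + 1 <= n] blocks. *)
          apply: (@pow_lew _ (size (feed k t'))); last exact: code_lt (all_feed pt' mn).
          by rewrite feed_ins //= size_top_positions st (leq_trans _ mn) // ltnS geq_minr.
        rewrite feed_ins // code_cons /= => ltw.
        by rewrite [_ * 2 ^ b %% _]modn_small ?modn_small // (leq_ltn_trans (leq_addl _ _) ltw).
      apply: (cw_assign1 (v := size q + r.+1)).
        rewrite /= const1 modn_small ?addn1 ?addnS //; apply: leq_ltn_trans ltq.
        by rewrite size_cat kidsE size_map -addnS leq_add2l.
      do 4!eexists; split; first by [].
      + rewrite (take_nth 0) // map_rcons -rcons_cat; exact: stored_rcons.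
      + exact: bits_pop.
      + by rewrite /upd /= [aext == aq]eq_sym (negPf q2).
      + by rewrite /upd (negPf c3) [ac == aq]eq_sym (negPf qc).
    * move=> s [E' [i [bp [A' [-> _ bE _ _]]]]].
      by apply: bits_eq0 => j /=; rewrite bE drop_size.
    * exists E, ji, jbp, A2; rewrite addn0 take0 cats0 drop0.
      by split.
  + move=> s [E' [i [bp [A' [-> stA' _ Ae Ac]]]]].
    exists E', i, bp, A'; rewrite -A2e -A2c; split=> //.
      by rewrite size_cat kidsE size_map.
    by rewrite kidsE; move: stA'; rewrite take_size.
  + by rewrite kidsE size_map /= ecost_child; lia.
- by rewrite /=; lia.
Qed.

Definition ext_ok (A : nat -> nat -> nat) (t : seq nat) : Prop :=
  forall i, testbit (A aext (code b t)) i =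
            (i <= size t) && avoids Pi (ins t i (size t).+1).

Lemma init_ok m t A lim tail head lend F jE ji jD jpos ji0 jp jbp je :
  is_perm m t -> m < n ->
  computes_within
    (If (Reg rm [<] Reg rk) filter_patterns
       (rE ::= (Const 1 [<<] (Reg rm [+] Const 1)) [-] Const 1)) w
    (mk [:: n; k; b; lim; m; tail; head; lend; code b t; F; jE; ji; jD; jpos; ji0; jp; jbp; je]
        A tables)
    (fun s => exists E i bp,
       s = mk [:: n; k; b; lim; m; tail; head; lend; code b t; F; E; i; jD; jpos; ji0; jp; bp; je]
              A tables
       /\ forall j, testbit E j = (j <= m) && (ins t j m.+1 \notin Pi))
    (45 * (minn k m).+1 + 24).
Proof.
move=> pt mn; have nw := n_ltw; apply: cw_le.
  (* Queries are made only for [m < k], where [m] equals [minn k m]; so both branches fit a budget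
     in terms of [minn k m]. *)
  apply: (cw_if (c := m < k) (U := 45 * (minn k m).+1 + 20)) => //.
  case: ltnP => [_|km]; first exact: filter_ok.
  apply: cw_weaken.
  - apply: (cw_assign1 (v := 2 ^ m.+1 - 1)).
      rewrite /= succ_word; last by lia.
      rewrite shl1; last by lia.
      have p0 : 0 < 2 ^ m.+1 by rewrite expn_gt0.
      have lt : 2 ^ m.+1 < 2 ^ w by rewrite ltn_exp2l //; lia.
      rewrite const1; have -> : 2 ^ m.+1 + (2 ^ w - 1) = 2 ^ m.+1 - 1 + 2 ^ w by lia.
      by rewrite modnDr modn_small //; lia.
    by instantiate (1 := eq _).
  - move=> _ <-; do 3!eexists; split; first by [].
    move=> j; rewrite testbit_ones ltnS; case: leqP => //= jm.
    apply/esym/negP=> inPi; have [_ st _] := is_permP pt.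
    have : size (ins t j m.+1) <= k by rewrite /max_length (big_rem _ inPi) leq_maxl.
    by rewrite size_ins st ltnNge km.
  - by rewrite /=; lia.
by rewrite /=; lia.
Qed.

Lemma process_ok m t A lim q head lend jF jE ji jD jpos ji0 jp jbp je :
  t \in level Pi m -> m < n ->
  jF = code b (feed k t) ->
  (forall u, 0 < m -> u \in level Pi m.-1 -> ext_ok A u) ->
  stored A q -> size (q ++ enqueued lim t) < 2 ^ w ->
  A ac m.+1 + size (kids Pi t) < 2 ^ w ->
  computes_within (process aq ac) w
    (mk [:: n; k; b; lim; m; size q; head; lend; code b t; jF; jE; ji; jD;
            jpos; ji0; jp; jbp; je] A tables)
    (fun s => exists j0 j1 j2 j3 j4 j5 j6 j7 j8 j9 A' E,
       [/\ s = mk [:: n; k; b; lim; m; size (q ++ enqueued lim t); head; lend;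
                   j0; j1; j2; j3; j4; j5; j6; j7; j8; j9] A' tables,
           stored A' (q ++ enqueued lim t),
           A' aext = upd (A aext) (code b t) E,
           (forall i, testbit E i = (i <= m) && avoids Pi (ins t i m.+1))
         & A' ac = upd (A ac) m.+1 (A ac m.+1 + size (kids Pi t))])
    (200 * ((minn k m).+1 + size (enqueued lim t))).
Proof.
rewrite mem_level // => /andP[pt avt] mn -> ext stA ltq ltc.
have [ut st _] := is_permP pt.
apply: cw_le.
  apply: cw_seq; first exact: init_ok.
  move=> _ [E0 [i0 [bp0 [-> bits0]]]].
  apply: cw_seq.
    (* A deletion from [t] gives a word of level [m - 1], whose bit map is already stored. *)
    apply: delete_ok => // l lt i; have jt : m - l \in t by rewrite (mem_is_perm _ pt); lia.
    have permd := is_perm_del pt jt; have [_ sd _] := is_permP permd.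
    have m0 : 0 < m by lia.
    rewrite ext // ?mem_level ?permd ?(avoids_del_perm _ _ pt) //.
    by rewrite sd prednK // -ltnS prednK.
  move=> _ [F [E [i [D [i1 [p [bp [e [-> bits]]]]]]]]].
  have bitsE j : testbit E j = (j <= m) && avoids Pi (ins t j m.+1).
    rewrite bits bits0; case: leqP => //= jm.
    rewrite (avoids_ins pPi pt) //; congr andb; apply: eq_in_all => l.
    (* The range condition is automatic: only the gap [m] could violate it, and the deleted letter
       stands before that gap. *)
    rewrite mem_iota => /andP[_ lm]; rewrite andb_idl // => _.
    have : index (m - l) t < m by rewrite -[X in _ < X]st index_mem (mem_is_perm _ pt); lia.
    by clear - jm; lia.
  apply: cw_weaken; first exact: emit_ok bitsE stA ltq ltc.
  - move=> s [E' [i' [bp' [A' [-> stA' Ae Ac]]]]].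
    by do 11!eexists; exists E; split; [| exact: stA'|exact: Ae|exact: bitsE|exact: Ac].
  - by [].
by clear; lia.
Qed.

(** Distinct permutations have distinct codes, so recording the map of [t] disturbs no other map. *)
Lemma ext_ok_upd A A' m t E i u :
  t \in level Pi m -> m <= n -> u \in level Pi i -> i <= n ->
  A' aext = upd (A aext) (code b t) E ->
  (forall j, testbit E j = (j <= m) && avoids Pi (ins t j m.+1)) ->
  u = t \/ ext_ok A u -> ext_ok A' u.
Proof.
rewrite !mem_level // => /andP[pt _] mn /andP[pu _] i_n Ae bits ext.
have [_ st _] := is_permP pt.
have [ut|ut] := eqVneq u t; first by move=> j; rewrite Ae ut /upd eqxx bits st.
case: ext => [/eqP|ext]; first by rewrite (negPf ut).
move=> j; rewrite Ae /upd ifN ?ext //; apply: contraNneq ut => eqc.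
exact/eqP/(code_perm_inj pu pt).
Qed.

(** The codes of these nonempty words are distinct positive numbers below [2 ^ (b * n)]. Hence
    neither queue indices nor counts overflow. *)
Lemma size_levels_lt : size (levels Pi n) < 2 ^ w.
Proof.
apply: (@pow_lew _ n) => //.
have uc : uniq (map (code b) (levels Pi n)).
  rewrite map_inj_in_uniq ?uniq_levels // => t u.
  rewrite !mem_levels // => /and3P[/andP[_ tn] pt _] /and3P[/andP[_ un] pu _].
  exact: code_perm_inj pt pu tn un.
have sub : {subset map (code b) (levels Pi n) <= iota 1 (2 ^ (b * n)).-1}.
  move=> c /mapP[t]; rewrite mem_levels // => /and3P[/andP[t0 tn] pt _] ->.
  rewrite mem_iota add1n prednK ?expn_gt0 // lt0n; apply/andP; split.
    apply/eqP; rewrite -(code_nil b) => eqc.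
    by move: t0; rewrite (code_perm_inj pt (perm_refl _ : is_perm 0 [::]) tn _ eqc).
  apply: leq_trans (code_perm_lt pt tn) _.
  by rewrite leq_exp2l // leq_mul2l tn orbT.
have := uniq_leq_size uc sub; rewrite size_map size_iota.
by move=> le; rewrite -[X in _ < X]prednK ?expn_gt0.
Qed.

Lemma size_levels_mono m1 m2 : m1 <= m2 -> size (levels Pi m1) <= size (levels Pi m2).
Proof.
move=> le; rewrite -(subnKC le); elim: (m2 - m1) => [|d IH]; first by rewrite addn0.
by rewrite addnS levelsS size_cat (leq_trans IH) // leq_addr.
Qed.

Lemma size_level_lt m : 0 < m <= n -> size (level Pi m) < 2 ^ w.
Proof.
case: m => // m mn; apply: leq_ltn_trans size_levels_lt.
by apply: leq_trans (size_levels_mono mn); rewrite levelsS size_cat leq_addl.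
Qed.

Lemma level_nil m j : level Pi m = [::] -> m <= j -> level Pi j = [::].
Proof.
move=> lm le; rewrite -(subnKC le); elim: (j - m) => [|d IH]; first by rewrite addn0.
by rewrite addnS /= IH.
Qed.

Lemma levels_nil m j : level Pi m.+1 = [::] -> m <= j -> levels Pi j = levels Pi m.
Proof.
move=> lm le; rewrite -(subnKC le); elim: (j - m) => [|d IH]; first by rewrite addn0.
by rewrite addnS levelsS (level_nil lm) ?cats0 // ltnS leq_addr.
Qed.

(** * The search level by level *)

Variable lim : nat.
Hypothesis lim_bounds : n.-1 <= lim <= n.

Lemma flatten_enqueued m :
  flatten (map (enqueued lim) (level Pi m)) = if m < lim then level Pi m.+1 else [::].
Proof.
have -> : map (enqueued lim) (level Pi m) =
          map (fun t => if m < lim then kids Pi t else [::]) (level Pi m).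
  apply/eq_in_map => t; rewrite mem_level // => /andP[/is_permP[_ st _] _].
  by rewrite /enqueued st.
by case: ifP => // _; elim: (level Pi m).
Qed.

(** The invariant of the main loop: the head of the queue is where level [m] begins, the maps of all
    shorter words are known, and the counts are complete up to length [m]. *)
Definition at_level (m : nat) (s : state) : Prop :=
  exists lend j0 j1 j2 j3 j4 j5 j6 j7 j8 j9 A,
  [/\ s = mk [:: n; k; b; lim; m; size (levels Pi (minn m lim)); size (levels Pi m.-1); lend;
              j0; j1; j2; j3; j4; j5; j6; j7; j8; j9] A tables,
      stored A (levels Pi (minn m lim)),
      (forall i t, i < m -> t \in level Pi i -> ext_ok A t)
    & forall i, A ac i = if 0 < i <= m then size (level Pi i) else 0].

Lemma next_level_ok m s :
  0 < m < n -> at_level m s ->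
  computes_within (next_level aq ac) w s (at_level m.+1)
    (size (level Pi m) * (200 * k + 220)
     + 200 * (size (levels Pi (minn m.+1 lim)) - size (levels Pi m)) + 20).
Proof.
move=> /andP[m0 mn] [lend [j0 [j1 [j2 [j3 [j4 [j5 [j6 [j7 [j8 [j9 [A [-> stA extA cA]]]]]]]]]]]]].
have mlim : minn m lim = m by apply/minn_idPl; lia.
rewrite mlim in stA *.
(* [q r] is the queue once the first [r] words of the level are processed. *)
pose q r := levels Pi m ++ flatten (map (enqueued lim) (take r (level Pi m))).
have q_end : q (size (level Pi m)) = levels Pi (minn m.+1 lim).
  rewrite /q take_size flatten_enqueued; case: ltnP => ml.
    by rewrite (minn_idPl _) // levelsS.
  by rewrite cats0; congr levels; lia.
have levelsE : levels Pi m = levels Pi m.-1 ++ level Pi m by rewrite -{1 3}(prednK m0) levelsS.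
pose I r s := exists j0 j1 j2 j3 j4 j5 j6 j7 j8 j9 A,
  [/\ s = mk [:: n; k; b; lim; m; size (q r); size (levels Pi m.-1) + r; size (levels Pi m);
              j0; j1; j2; j3; j4; j5; j6; j7; j8; j9] A tables,
      stored A (q r),
      (forall i t, i < m -> t \in level Pi i -> ext_ok A t),
      (forall t, t \in take r (level Pi m) -> ext_ok A t)
    & forall i, A ac i = if 0 < i <= m then size (level Pi i) else
        if i == m.+1 then size (flatten (map (kids Pi) (take r (level Pi m)))) else 0].
pose U r := 200 * ((minn k m).+1 + size (enqueued lim (nth [::] (level Pi m) r))) + 10.
have loop s1 : I 0 s1 -> computes_within (While (Reg rhead [<] Reg rend) (level_body aq ac))
    w s1 (I (size (level Pi m))) (\sum_(r < size (level Pi m)) (U r + 4) + 4).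
  apply: cw_while => [r {}s1 lt|{}s1]; last first.
    move=> [i0 [i1 [i2 [i3 [i4 [i5 [i6 [i7 [i8 [i9 [A' [-> _ _ _ _]]]]]]]]]]]].
    by rewrite /= levelsE size_cat ltnn.
  move=> [i0 [i1 [i2 [i3 [i4 [i5 [i6 [i7 [i8 [i9 [A' [-> stA' extA' extA1 cA']]]]]]]]]]]].
  set t := nth [::] (level Pi m) r; have tm : t \in level Pi m by exact: mem_nth.
  have headlt : size (levels Pi m.-1) + r < size (levels Pi m) by rewrite levelsE size_cat ltn_add2l.
  have sz_take (f : seq nat -> seq (seq nat)) :
      size (flatten (map f (take r.+1 (level Pi m)))) <= size (flatten (map f (level Pi m))).
    by rewrite -{2}(cat_take_drop r.+1 (level Pi m)) map_cat flatten_cat size_cat leq_addr.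
  have takeE (f : seq nat -> seq (seq nat)) :
      flatten (map f (take r.+1 (level Pi m))) =
      flatten (map f (take r (level Pi m))) ++ f t.
    by rewrite (take_nth [::]) // map_rcons flatten_rcons.
  have qS : q r.+1 = q r ++ enqueued lim t by rewrite /q takeE catA.
  have nth_head : nth [::] (q r) (size (levels Pi m.-1) + r) = t.
    by rewrite /q nth_cat headlt levelsE nth_cat ltnNge leq_addr /= addKn.
  have head_q : size (levels Pi m.-1) + r < size (q r).
    by apply: leq_trans headlt _; rewrite size_cat leq_addr.
  have [codet feedt] := stA' _ head_q; rewrite nth_head in codet feedt.
  split; first by rewrite /= headlt.
  apply: cw_le.
  - apply: (cw_assign (v := code b t)) => //.
    apply: (cw_assign (v := code b (feed k t))) => //.
    apply: cw_seq.
      apply: (process_ok (q := q r)) => //.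
      + by move=> u _ um; apply: (extA' m.-1) => //; lia.
      + rewrite -qS; apply: leq_ltn_trans size_levels_lt.
        apply: leq_trans (_ : size (q (size (level Pi m))) <= _).
          by rewrite /q !size_cat leq_add2l take_size sz_take.
        by rewrite q_end size_levels_mono //; lia.
      + rewrite cA' eqxx ltnn andbF -size_cat -takeE.
        apply: leq_ltn_trans (sz_take _) _.
        by apply: (@size_level_lt m.+1).
    move=> _ [l0 [l1 [l2 [l3 [l4 [l5 [l6 [l7 [l8 [l9 [A2 [E [-> stA2 Ae bits Ac]]]]]]]]]]]]].
    apply: (cw_assign1 (v := size (levels Pi m.-1) + r.+1)).
      rewrite /= const1 addn1 addnS modn_small //.
      apply: leq_ltn_trans headlt _; apply: leq_ltn_trans size_levels_lt.
      by apply: size_levels_mono; lia.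
    rewrite -qS in stA2 *.
    do 11!eexists; split; first by [].
    + exact: stA2.
    + move=> i u im ui; apply: (ext_ok_upd tm _ ui _ Ae bits); [lia | lia |].
      by right; exact: extA' ui.
    + move=> u; rewrite (take_nth [::]) // -/t mem_rcons inE => ut.
      have um : u \in level Pi m.
        by case/orP: ut => [/eqP->|/mem_take].
      apply: (ext_ok_upd tm _ um _ Ae bits); [lia | lia |].
      by case/orP: ut => [/eqP|/extA1]; [left | right].
    + move=> i; rewrite Ac /upd; case: eqP => [->|neq].
        by rewrite ltnn andbF takeE size_cat cA' eqxx ltnn andbF.
      by rewrite cA'; case: ifP => // _; rewrite ifN //; exact/eqP.
  - by rewrite /U -/t /=; clear; lia.
apply: cw_le.
- apply: (cw_assign (v := size (levels Pi m))) => //.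
  apply: cw_seq.
    apply: loop; do 11!eexists; split; first by rewrite /q take0 cats0 addn0.
    - by rewrite /q take0 cats0.
    - exact: extA.
    - by move=> t; rewrite take0.
    - by move=> i; rewrite cA take0; case: ifP => // _; case: ifP.
  move=> s1 [i0 [i1 [i2 [i3 [i4 [i5 [i6 [i7 [i8 [i9 [A' [-> stA' extA' extA1 cA']]]]]]]]]]]].
  apply: (cw_assign1 (v := m.+1)); first by rewrite /= succ_word //; have := n_ltw; lia.
  rewrite q_end in stA' *; rewrite take_size in extA1 cA'.
  do 12!eexists; split; first by rewrite levelsE size_cat.
  - exact: stA'.
  - move=> i t; rewrite ltnS leq_eqVlt => /orP[/eqP->|]; [exact: extA1 | exact: extA'].
  - move=> i; rewrite cA' /= [i <= m.+1]leq_eqVlt.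
    case: (i =P m.+1) => [->|_] /=; last by [].
    by rewrite ltnn.
(* The numbers of queued children add up to the growth of the queue, so each child is paid for
   once. *)
- have -> : \sum_(r < size (level Pi m)) (U r + 4) =
      size (level Pi m) * (200 * (minn k m).+1 + 14)
      + 200 * (size (levels Pi (minn m.+1 lim)) - size (levels Pi m)).
    rewrite -q_end /q take_size size_cat addKn size_flatten sumnE !big_map.
    rewrite [in RHS](big_nth [::]) big_mkord big_distrr /=.
    rewrite -[size (level _ _) in X in _ = X + _]card_ord -sum_nat_const -big_split /=.
    by apply: eq_bigr => r _; rewrite /U; lia.
  have : size (level Pi m) * (200 * (minn k m).+1 + 14) <= size (level Pi m) * (200 * k + 220).
    by rewrite leq_mul2l; apply/orP; right; lia.
  by rewrite /=; lia.
Qed.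

(** The bound acts as a potential: each word of length [m] to [n - 1] still to be processed pays
    order [k], and each word still to be queued pays a constant. *)
Lemma loop_ok m s :
  0 < m <= n -> at_level m s ->
  computes_within
    (While ((Reg rhead [<] Reg rtail) [&] (Reg rm [<] Reg rn)) (next_level aq ac)) w s
    (fun s' => exists l A,
       [/\ s' = mk l A tables, nth 0 l rtail = size (levels Pi lim), stored A (levels Pi lim)
         & forall i, 0 < i <= n -> A ac i = size (level Pi i)])
    ((size (levels Pi n.-1) - size (levels Pi m.-1)) * (200 * k + 260)
     + 200 * (size (levels Pi lim) - size (levels Pi (minn m lim))) + 10).
Proof.
have [d] : exists d, m + d = n \/ n < m by exists (n - m); lia.
case=> [|nm]; last by lia.
elim: d m s => [|d IH] m s eqn mb.
  rewrite addn0 in eqn; subst m.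
  move=> [lend [j0 [j1 [j2 [j3 [j4 [j5 [j6 [j7 [j8 [j9 [A [-> stA extA cA]]]]]]]]]]]]].
  have limE : minn n lim = lim by apply/minn_idPr; lia.
  rewrite limE in stA *.
  apply: cw_le; first apply: cw_while_stop.
  - by rewrite /= land_bool ltnn andbF.
  - do 2!eexists; split; [by []|by []|exact: stA|].
    by move=> i ib; rewrite cA ib.
  - exact: leq_trans (leq_addl _ _).
move=> als; have := als.
move=> [lend [j0 [j1 [j2 [j3 [j4 [j5 [j6 [j7 [j8 [j9 [A [sE stA extA cA]]]]]]]]]]]]].
have mlim : minn m lim = m by apply/minn_idPl; lia.
have mn : m < n by lia.
have levelsE : levels Pi m = levels Pi m.-1 ++ level Pi m.
  by case: (m) mb => // m' _; rewrite levelsS.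
rewrite mlim in sE stA *.
(* An empty level makes all later ones empty. The test for an empty queue then ends the loop at
   once, so empty levels cost no time. *)
have [lm|/eqP lm] := eqVneq (level Pi m) [::].
  have limE : levels Pi lim = levels Pi m.
    have -> : levels Pi m = levels Pi m.-1 by rewrite levelsE lm cats0.
    by apply: levels_nil; [rewrite prednK //; lia | lia].
  apply: cw_le; first apply: cw_while_stop.
  - by rewrite sE /= land_bool levelsE lm cats0 ltnn.
  - rewrite limE; do 2!eexists; split; [exact: sE|by []|exact: stA|].
    move=> i ib; rewrite cA; case: ifP => // im.
    by rewrite (level_nil lm) //; lia.
  - exact: leq_trans (leq_addl _ _).
have lm0 : 0 < size (level Pi m) by case: (level Pi m) lm.
apply: cw_le.
- apply: (cw_while_step (P := at_level m.+1)).
  + by rewrite sE /= land_bool mn levelsE size_cat -ltn_subLR ?subnn ?lm0.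
  + by apply: next_level_ok als; lia.
  + by move=> s' als'; apply: IH als'; lia.
- have le1 : size (levels Pi m) <= size (levels Pi n.-1) by apply: size_levels_mono; lia.
  have le2 : size (levels Pi m) <= size (levels Pi (minn m.+1 lim)).
    by apply: size_levels_mono; lia.
  have le3 : size (levels Pi (minn m.+1 lim)) <= size (levels Pi lim).
    by apply: size_levels_mono; lia.
  have -> : size (levels Pi n.-1) - size (levels Pi m.-1) =
      (size (levels Pi n.-1) - size (levels Pi m)) + size (level Pi m).
    by move: le1; rewrite levelsE size_cat; lia.
  (* The level has at least one word, so 40 extra units per word cover the fixed cost of the
     round. *)
  have le4 : size (level Pi m) * (200 * k + 220) + 40 <= size (level Pi m) * (200 * k + 260).
    by rewrite !mulnDr -addnA leq_add2l; lia.
  rewrite mulnDl /=; move: le1 le2 le3 le4.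
  move: (_ * (200 * k + 260)) (_ * (200 * k + 260)) (_ * (200 * k + 220)) => x y z.
  by lia.
Qed.

Lemma input_mk :
  input n b Pi = mk [:: n; k; b; 0; 0; 0; 0; 0; 0; 0; 0; 0; 0; 0; 0; 0; 0; 0]
                    (fun _ _ => 0) tables.
Proof.
congr State; apply: functional_extensionality => x.
by do 18!(case: x => [|x] //=); rewrite !nth_nil.
Qed.

Lemma enumerate_ok d :
  d <= 1 -> lim = n - d ->
  computes_within (enumerate aq ac d) w (input n b Pi)
    (fun s' => exists l A,
       [/\ s' = mk l A tables, nth 0 l rtail = size (levels Pi lim), stored A (levels Pi lim)
         & forall i, 0 < i <= n -> A ac i = size (level Pi i)])
    (460 * (size (levels Pi n.-1) * k) + 200 * size (levels Pi lim) + 500).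
Proof.
move=> d1 limE; have nw := n_ltw; rewrite input_mk.
have lt_kids : size (kids Pi [::]) <= 1 by rewrite size_map size_filter count_size.
have lt_enq : size (enqueued lim [::]) <= 1 by rewrite /enqueued; case: ifP.
have w1 : 1 < 2 ^ w by rewrite -{1}[1](expn0 2) ltn_exp2l //; lia.
apply: cw_le.
- apply: (cw_assign (v := lim)).
    have nW : n < 2 ^ w by rewrite (leq_trans (ltn_expl n (ltnSn 1))) // leq_exp2l // ltnW.
    rewrite /= [d %% _]modn_small; last by lia.
    have -> : n + (2 ^ w - d) = n - d + 2 ^ w by lia.
    by rewrite modnDr -limE modn_small // limE; apply: leq_ltn_trans nW; exact: leq_subr.
  apply: cw_seq.
    (* The initial 0 in the registers is already the code of the empty word and of its feed. *)
    have -> : mk (set_nth 0 [:: n; k; b; 0; 0; 0; 0; 0; 0; 0; 0; 0; 0; 0; 0; 0; 0; 0] rlim lim)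
                 (fun _ _ => 0) tables =
              mk [:: n; k; b; lim; 0; 0; 0; 0; code b [::]; 0; 0; 0; 0; 0; 0; 0; 0; 0]
                 (fun _ _ => 0) tables by rewrite code_nil.
    apply: (process_ok (q := [::]) (t := [::])) => //.
    + by rewrite /feed code_cons code_nil.
    + exact: leq_ltn_trans lt_enq _.
    + exact: leq_ltn_trans lt_kids _.
  move=> _ [l0 [l1 [l2 [l3 [l4 [l5 [l6 [l7 [l8 [l9 [A [E [-> stA Ae bits Ac]]]]]]]]]]]]].
  apply: (cw_assign (v := 1)); first by rewrite /= const1.
  apply: (@loop_ok 1); first by lia.
  have qE : [::] ++ enqueued lim [::] = levels Pi (minn 1 lim).
    rewrite /enqueued /=; case: (lim) => [|l'] //.
    by rewrite (minn_idPl _) // /levels /= !cats0.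
  rewrite qE in stA *.
  do 12!eexists; split; [by []|exact: stA| |].
  + move=> [|//] t _ tl; apply: (ext_ok_upd (t := [::]) (A := fun _ _ => 0) _ _ tl _ Ae bits) => //.
    by left; move: tl; rewrite inE => /eqP.
  + by move=> i; rewrite Ac /upd; case: i => [|[|i]] //; rewrite /= cats0.
(* As [k >= 1], the constant cost per word is absorbed into a multiple of [k]. *)
- have k0 := k_gt0; rewrite minn0 [X in X * (200 * k + 260)]subn0.
  have le : size (levels Pi n.-1) * (200 * k + 260) <= 460 * (size (levels Pi n.-1) * k).
    by rewrite mulnCA leq_mul2l; apply/orP; right; lia.
  by clear - le lt_enq; rewrite /=; lia.
Qed.

End Correctness.

(** * The two running times *)

Theorem theorem4p6 :
  (exists (c : cmd) (C : nat),
     forall (Pi : seq (seq nat)) (n b w : nat),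
       pattern_set Pi -> 0 < n -> word_size_ok n (max_length Pi) b w ->
       computes_within c w (input n b Pi) (outputs_counts n Pi)
         (C * (size (Av_le n.-1 Pi) * max_length Pi + 1)))
  /\
  (exists (c : cmd) (C : nat),
     forall (Pi : seq (seq nat)) (n b w : nat),
       pattern_set Pi -> 0 < n -> word_size_ok n (max_length Pi) b w ->
       computes_within c w (input n b Pi) (outputs_set n b Pi)
         (C * (size (Av_le n.-1 Pi) * max_length Pi + size (Av n Pi) + 1))).
Proof.
split.
  (* Queue in array 1, counts in array 0. With [d = 1] the words of length [n] are only counted, by
     popcount on their parents, so they cost nothing individually. *)
  exists (enumerate 1 0 1), 700 => Pi n b w pPi n0 ok.
  have k0 := k_gt0 pPi.
  apply: cw_weaken.
  - apply: (@enumerate_ok Pi n b w pPi n0 ok 1 0 isT (n - 1)) => //.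
    by rewrite subn1 leqnn leq_pred.
  - move=> s [l [A [-> _ _ cA]]] j jn /=.
    by rewrite cA // size_level.
  - rewrite subn1 size_levels //.
    have le : size (Av_le n.-1 Pi) <= size (Av_le n.-1 Pi) * max_length Pi by rewrite leq_pmulr.
    by clear - le; lia.
(* With [d = 0] the queue, now in array 0, ends up as the required list, and its length is copied to
   register 0. *)
exists (enumerate 0 1 0 ;; rn ::= Reg rtail), 700 => Pi n b w pPi n0 ok.
have k0 := k_gt0 pPi.
apply: cw_le.
  apply: cw_seq.
    apply: (@enumerate_ok Pi n b w pPi n0 ok 0 1 isT n) => //.
    - by rewrite leqnn leq_pred.
    - by rewrite subn0.
  move=> s [l [A [-> tailE stA cA]]].
  apply: (cw_assign1 (v := size (levels Pi n))) => //.
  rewrite /outputs_set /=.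
  have -> : nth 0 (set_nth 0 l 0 (size (levels Pi n))) 0 = size (levels Pi n).
    by rewrite nth_set_nth.
  have -> : [seq A 0 i | i <- iota 0 (size (levels Pi n))] = map (code b) (levels Pi n).
    rewrite -[X in _ = map _ X](mkseq_nth [::]) -map_comp; apply/eq_in_map => i.
    by rewrite mem_iota => /andP[_ /stA[]].
  by apply: perm_map; exact: levels_Av_le.
(* Words of length [n] are queued at constant cost but never processed, which gives the summand
   without the factor [k]. *)
have szE : size (levels Pi n) = size (levels Pi n.-1) + size (Av n Pi).
  by rewrite -size_level // -{1 3}(prednK n0) levelsS size_cat.
rewrite szE size_levels //.
have le : size (Av_le n.-1 Pi) <= size (Av_le n.-1 Pi) * max_length Pi by rewrite leq_pmulr.
by clear - le; rewrite /=; lia.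
Qed.
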